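(* Let $D$ be a Dyck path of semilength $n\ge1$ with coarea sequence $(d_0,\dots,d_n)$, and let $A$ be the $(n+1)$-LNakayama algebra whose Kupisch series equals the area sequence of $\zeta(D)$. For $1\le j\le n$ put $$k(j)=\#\{0\le i\le n : d_i<d_j\}+\#\{0\le i<j : d_i=d_j\}-1.$$ Then for every $1\le j\le n$: (1) $D$ has a peak with $y$-coordinate $j$ if and only if the simple $A$-module $S_{k(j)}$ has projective dimension $1$; (2) $D$ has a $1$-rise with $y$-coordinate $j$ if and only if $S_{k(j)}$ is $1$-regular.
   Context: Fix a field $\mathbb{F}$. An $m$-LNakayama algebra is $A=\mathbb{F}Q/I$ with $Q$ the linear quiver $0\to\cdots\to m-1$ and $I$ admissible ($J^r\subseteq I\subseteq J^2$, $r\ge2$, $J$ the arrow ideal); modules are right modules, $S_i$ the simple at vertex $i$, Kupisch series $c_i=\dim_{\mathbb{F}} e_iA$; LNakayama algebras are determined up to isomorphism by their Kupisch series, and every Dyck path area sequence of semilength $m-1$ is a Kupisch series. A simple module $S$ is $1$-regular if $\operatorname{pd}(S)=1$, $\operatorname{Hom}_A(S,A)=0$ and $\dim_{\mathbb{F}}\operatorname{Ext}^1_A(S,A)=1$. Lattice paths use horizontal steps $(x,y)\to(x,y+1)$ and vertical steps $(x,y)\to(x+1,y)$. A Dyck path of semilength $n$ goes from $(0,0)$ to $(n,n)$ staying in $y\ge x$. Area sequence: $c_k=h_k-k+1$, $h_k$ the largest $y$ with $(k,y)$ on the path; coarea sequence: $d_k=k-g_k+1$, $g_k$ the smallest $x$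 with $(x,k)$ on the path ($0\le k\le n$). Zeta map: with $m=\max_k d_k$ and $a_2=\#\{i: d_i=2\}$, $\zeta(D)$ is the concatenation $h^{a_2}w_2w_3\cdots w_m$, where $h$ is a horizontal step and $w_k$ is the word obtained by reading $d_1,\dots,d_n$ from left to right and writing a vertical step for each entry equal to $k$ and a horizontal step for each entry equal to $k+1$. A peak with $y$-coordinate $j$ is a horizontal step ending at some $(x,j)$ immediately followed by a vertical step. A $1$-rise with $y$-coordinate $j$ is a horizontal step $(x,j-1)\to(x,j)$ that is neither immediately preceded nor immediately followed by a horizontal step. *)

(* Defs.v *)
From HB Require Import structures.
From mathcomp Require Import all_boot all_order all_algebra all_field.

Set Implicit Arguments.
Unset Strict Implicit.
Unset Printing Implicit Defensive.

Import GRing.Theory.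

Local Open Scope nat_scope.

(* A lattice path from (0, 0) is its word of steps: a horizontal step is      *)
(* (x, y) -> (x, y + 1) and a vertical step is (x, y) -> (x + 1, y).          *)
Notation step := bool (only parsing).
Notation hstep := true (only parsing).
Notation vstep := false (only parsing).

(* (xcoord D i, ycoord D i) is the point reached after the first i steps.     *)
Definition xcoord (D : seq step) (i : nat) : nat := count_mem vstep (take i D).
Definition ycoord (D : seq step) (i : nat) : nat := count_mem hstep (take i D).

Definition is_dyck (n : nat) (D : seq step) : Prop :=
  [/\ xcoord D (size D) = n, ycoord D (size D) = n
    & forall i, i <= size D -> xcoord D i <= ycoord D i].

Definition area_h (D : seq step) (k : nat) : nat :=
  \max_(i < (size D).+1 | xcoord D i == k) ycoord D i.

(* The default value size D of the minimum bounds every x-coordinate on D.    *)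
Definition coarea_g (D : seq step) (k : nat) : nat :=
  \big[minn/size D]_(i < (size D).+1 | ycoord D i == k) xcoord D i.

(* For 0 <= k <= n and D a Dyck path of semilength n, k <= area_h D k and     *)
(* coarea_g D k <= k, so that neither subtraction is truncated.               *)
Definition area (D : seq step) (k : nat) : nat := (area_h D k - k).+1.
Definition coarea (D : seq step) (k : nat) : nat := (k - coarea_g D k).+1.

Definition zeta_word (s : seq nat) (k : nat) : seq step :=
  [seq (if d == k then vstep else hstep) | d <- s & (d == k) || (d == k.+1)].

Definition zeta (n : nat) (D : seq step) : seq step :=
  let s := [seq coarea D i | i <- iota 1 n] in
  let m := \max_(i < n.+1) coarea D i in
  let a2 := #|[set i : 'I_n.+1 | coarea D i == 2]| in
  nseq a2 hstep ++ flatten [seq zeta_word s k | k <- index_iota 2 m.+1].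

Definition has_peak (D : seq step) (j : nat) : Prop :=
  exists i, [/\ i.+1 < size D, nth vstep D i = hstep,
                nth hstep D i.+1 = vstep & ycoord D i.+1 = j].

Definition has_one_rise (D : seq step) (j : nat) : Prop :=
  exists i, [/\ i < size D /\ nth vstep D i = hstep, ycoord D i.+1 = j,
                ~ (0 < i /\ nth vstep D i.-1 = hstep)
              & ~ (i.+1 < size D /\ nth vstep D i.+1 = hstep)].

Definition kindex (n : nat) (D : seq step) (j : nat) : nat :=
  #|[set i : 'I_n.+1 | coarea D i < coarea D j]|
  + #|[set i : 'I_n.+1 | (i < j) && (coarea D i == coarea D j)]| - 1.

Lemma kindex_lt n D j : kindex n D j < n.+1.
Proof.
rewrite /kindex; set X := [set i | _]; set Y := [set i | _].
rewrite -cardsUI (_ : X :&: Y = set0).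
  rewrite cards0 addn0 ltnS leq_subLR add1n.
  by apply: leq_trans (max_card _) _; rewrite card_ord.
by apply/setP=> i; rewrite !inE; case: ltngtP; rewrite ?andbF.
Qed.

(* k(j), as a vertex of the quiver with n + 1 vertices.                       *)
Definition kvertex (n : nat) (D : seq step) (j : nat) : 'I_n.+1 :=
  Ordinal (kindex_lt n D j).

Local Open Scope ring_scope.

(* The linear quiver 0 -> 1 -> ... -> n has exactly one path from i to j when *)
(* i <= j and none otherwise, so a path is recorded by its two ends.          *)
Notation lpath n := {p : 'I_n.+1 * 'I_n.+1 | (p.1 <= p.2)%N}.

Definition psrc n (p : lpath n) : 'I_n.+1 := (val p).1.
Definition ptgt n (p : lpath n) : 'I_n.+1 := (val p).2.

(* p is the concatenation of q followed by r.                                 *)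
Definition path_comp n (q r p : lpath n) : bool :=
  [&& ptgt q == psrc r, psrc p == psrc q & ptgt p == ptgt r].

(* The path algebra: the vector space with basis the paths, with the          *)
(* concatenation product. Paths compose from left to right, so that e_i A is  *)
(* spanned by the paths starting at i.                                        *)
Definition pathalg (F : fieldType) (n : nat) : Type := {ffun lpath n -> F^o}.

Definition path_elt (F : fieldType) n (p : lpath n) : pathalg F n :=
  [ffun q : lpath n => (q == p)%:R].

Section PathAlgebra.
Variables (F : fieldType) (n : nat).
Local Notation FQ := (pathalg F n).
Implicit Types (f g h : FQ) (p q r s t : lpath n).

HB.instance Definition _ := GRing.Lmodule.copy FQ {ffun lpath n -> F^o}.

Definition pathalg_one : FQ := [ffun p : lpath n => (psrc p == ptgt p)%:R].
Definition pathalg_mul f g : FQ :=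
  [ffun p : lpath n => \sum_q \sum_(r | path_comp q r p) f q * g r].

Lemma lpath_inj p q : psrc p = psrc q -> ptgt p = ptgt q -> p = q.
Proof.
case: p q => [[a b] h] [[c d] h']; rewrite /psrc /ptgt /= => ac bd.
by apply: val_inj; rewrite /= ac bd.
Qed.

Lemma psrc_le_ptgt p : (psrc p <= ptgt p)%N.
Proof. exact: (valP p). Qed.

Lemma lpath_ex (i j : 'I_n.+1) :
  (i <= j)%N -> exists p, psrc p = i /\ ptgt p = j.
Proof.
move=> le_ij.
by exists (exist (fun p : 'I_n.+1 * 'I_n.+1 => (p.1 <= p.2)%N) (i, j) le_ij).
Qed.

Definition path_comp3 q t r p : bool :=
  [&& ptgt q == psrc t, ptgt t == psrc r, psrc p == psrc q & ptgt p == ptgt r].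

Lemma path_comp3l q t r p (c : F) :
  \sum_(s | path_comp q t s && path_comp s r p) c = if path_comp3 q t r p then c else 0.
Proof.
case: ifPn => [/and4P[/eqP qt /eqP tr /eqP pq /eqP pr]|no].
  have [|s [s1 s2]] := @lpath_ex (psrc q) (ptgt t).
    by rewrite (leq_trans (psrc_le_ptgt q)) // qt psrc_le_ptgt.
  rewrite (big_pred1 s) // => s'; apply/idP/eqP => [|->].
    case/andP=> /and3P[_ /eqP e1 /eqP e2] _.
    by apply: lpath_inj; rewrite ?s1 ?s2.
  by rewrite /path_comp s1 s2 qt tr pq pr !eqxx.
apply: big1 => s /andP[/and3P[/eqP e1 /eqP e2 /eqP e3] /and3P[/eqP e4 e5 e6]].
by case/negP: no; rewrite /path_comp3 e1 -e3 e4 -e2 e5 e6 !eqxx.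
Qed.

Lemma path_comp3r q t r p (c : F) :
  \sum_(s | path_comp t r s && path_comp q s p) c = if path_comp3 q t r p then c else 0.
Proof.
case: ifPn => [/and4P[/eqP qt /eqP tr /eqP pq /eqP pr]|no].
  have [|s [s1 s2]] := @lpath_ex (psrc t) (ptgt r).
    by rewrite (leq_trans (psrc_le_ptgt t)) // tr psrc_le_ptgt.
  rewrite (big_pred1 s) // => s'; apply/idP/eqP => [|->].
    case/andP=> /and3P[_ /eqP e1 /eqP e2] _.
    by apply: lpath_inj; rewrite ?s1 ?s2.
  by rewrite /path_comp s1 s2 qt tr pq pr !eqxx.
apply: big1 => s /andP[/and3P[/eqP e1 /eqP e2 /eqP e3] /and3P[/eqP e4 e5 e6]].
by case/negP: no; rewrite /path_comp3 e1 e4 -e2 -e3 e5 e6 !eqxx.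
Qed.

Lemma pathalg_mulA : associative pathalg_mul.
Proof.
move=> f g h; apply/ffunP => p; rewrite !ffunE.
transitivity (\sum_q \sum_t \sum_r
    if path_comp3 q t r p then f q * g t * h r else 0).
  apply: eq_bigr => q _.
  transitivity (\sum_s \sum_t \sum_r
      if path_comp t r s && path_comp q s p then f q * g t * h r else 0).
    rewrite big_mkcond; apply: eq_bigr => s _; case: ifPn => qs.
      rewrite ffunE mulr_sumr; apply: eq_bigr => t _.
      rewrite mulr_sumr big_mkcond; apply: eq_bigr => r _.
      by rewrite andbT mulrA.
    by rewrite big1 // => t _; rewrite big1 // => r _; rewrite andbF.
  rewrite exchange_big; apply: eq_bigr => t _.
  rewrite exchange_big; apply: eq_bigr => r _.
  by rewrite -big_mkcond path_comp3r.
transitivity (\sum_s \sum_r \sum_q \sum_t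
    if path_comp q t s && path_comp s r p then f q * g t * h r else 0); last first.
  apply: eq_bigr => s _; rewrite [RHS]big_mkcond; apply: eq_bigr => r _.
  case: ifPn => sr; last first.
    by rewrite big1 // => q _; rewrite big1 // => t _; rewrite andbF.
  rewrite ffunE mulr_suml; apply: eq_bigr => q _.
  rewrite mulr_suml [RHS]big_mkcond; apply: eq_bigr => t _.
  by rewrite andbT.
under [RHS]eq_bigr => s _ do rewrite exchange_big.
rewrite [RHS]exchange_big; apply: eq_bigr => q _.
under [RHS]eq_bigr => s _ do rewrite exchange_big.
rewrite [RHS]exchange_big; apply: eq_bigr => t _.
rewrite [RHS]exchange_big; apply: eq_bigr => r _.
by rewrite -big_mkcond path_comp3l.
Qed.

Lemma pathalg_mul1 : left_id pathalg_one pathalg_mul.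
Proof.
move=> f; apply/ffunP => p; rewrite ffunE.
have [e [e1 e2]] := lpath_ex (leqnn (psrc p)).
rewrite (bigD1 e) //= (big_pred1 p) => [|r /=].
  rewrite ffunE e1 e2 eqxx mul1r big1 ?addr0 // => q ne_qe.
  apply: big1 => r /and3P[_ /eqP pq _]; rewrite ffunE.
  case: eqP => [qq|]; last by rewrite mul0r.
  by case/eqP: ne_qe; apply: lpath_inj; rewrite ?e1 ?e2 -?qq pq.
rewrite /path_comp e1 e2 eqxx /=; apply/andP/eqP => [[/eqP a /eqP b]|->//].
exact: lpath_inj.
Qed.

Lemma pathalg_mulr1 : right_id pathalg_one pathalg_mul.
Proof.
move=> f; apply/ffunP => p; rewrite ffunE.
have [e [e1 e2]] := lpath_ex (leqnn (ptgt p)).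
rewrite (bigD1 p) //= [X in _ + X]big1 ?addr0 => [|q ne_qp].
  rewrite (bigD1 e) /=; last by rewrite /path_comp e1 e2 !eqxx.
  rewrite ffunE e1 e2 eqxx mulr1 big1 ?addr0 // => r /andP[].
  case/and3P=> _ _ /eqP pr ne_re; rewrite ffunE.
  case: eqP => [rr|]; last by rewrite mulr0.
  by case/eqP: ne_re; apply: lpath_inj; rewrite ?e1 ?e2 ?rr pr.
apply: big1 => r /and3P[/eqP qr /eqP pq /eqP pr]; rewrite ffunE.
case: eqP => [rr|]; last by rewrite mulr0.
by case/eqP: ne_qp; apply: lpath_inj; rewrite // pr qr.
Qed.

Lemma pathalg_mulDl : left_distributive pathalg_mul +%R.
Proof.
move=> f g h; apply/ffunP => p; rewrite !ffunE -big_split; apply: eq_bigr => q _.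
by rewrite -big_split; apply: eq_bigr => r _; rewrite ffunE mulrDl.
Qed.

Lemma pathalg_mulDr : right_distributive pathalg_mul +%R.
Proof.
move=> f g h; apply/ffunP => p; rewrite !ffunE -big_split; apply: eq_bigr => q _.
by rewrite -big_split; apply: eq_bigr => r _; rewrite ffunE mulrDr.
Qed.

Lemma pathalg_one_neq0 : pathalg_one != 0.
Proof.
have [e [e1 e2]] := lpath_ex (leqnn (ord0 : 'I_n.+1)).
apply/eqP => /ffunP/(_ e); rewrite !ffunE e1 e2 eqxx.
by move/eqP; rewrite oner_eq0.
Qed.

HB.instance Definition _ := GRing.Zmodule_isNzRing.Build FQ
  pathalg_mulA pathalg_mul1 pathalg_mulr1 pathalg_mulDl pathalg_mulDr
  pathalg_one_neq0.

Lemma pathalg_scaleAl (a : F) (f g : FQ) : a *: (f * g) = (a *: f) * g.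
Proof.
apply/ffunP => p; rewrite !ffunE scaler_sumr; apply: eq_bigr => q _.
by rewrite scaler_sumr; apply: eq_bigr => r _; rewrite ffunE scalerAl.
Qed.

HB.instance Definition _ :=
  GRing.Lmodule_isLalgebra.Build F FQ pathalg_scaleAl.

Lemma pathalg_scaleAr (a : F) (f g : FQ) : a *: (f * g) = f * (a *: g).
Proof.
apply/ffunP => p; rewrite !ffunE scaler_sumr; apply: eq_bigr => q _.
by rewrite scaler_sumr; apply: eq_bigr => r _; rewrite ffunE scalerAr.
Qed.

HB.instance Definition _ :=
  GRing.Lalgebra_isAlgebra.Build F FQ pathalg_scaleAr.

End PathAlgebra.

Definition triv_path n (i : 'I_n.+1) : lpath n :=
  exist _ (i, i) (leqnn i).

(* The idempotent e_i of the path algebra.                                    *)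
Definition vertex_elt (F : fieldType) n (i : 'I_n.+1) : pathalg F n :=
  path_elt F (triv_path i).

Definition is_arrow (F : fieldType) n (x : pathalg F n) : Prop :=
  exists2 p : lpath n, ptgt p = (psrc p).+1 :> nat & x = path_elt F p.

Section Ideals.
Variable R : nzRingType.
Implicit Types (S I J : R -> Prop) (x y : R).

Definition is_ideal I : Prop :=
  [/\ I 0, (forall x y, I x -> I y -> I (x + y)),
      (forall x y, I y -> I (x * y)) & (forall x y, I x -> I (x * y))].

Definition ideal_gen S x : Prop :=
  forall I, is_ideal I -> (forall y, S y -> I y) -> I x.

Definition ideal_mul I J : R -> Prop :=
  ideal_gen (fun z => exists x y, [/\ I x, J y & z = x * y]).

Fixpoint ideal_pow I (k : nat) : R -> Prop :=
  if k is k'.+1 then ideal_mul (ideal_pow I k') I else fun=> True.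

End Ideals.

Definition arrow_ideal (F : fieldType) n : pathalg F n -> Prop :=
  ideal_gen (@is_arrow F n).

Definition admissible (F : fieldType) n (I : pathalg F n -> Prop) : Prop :=
  is_ideal I /\
  exists2 r, (2 <= r)%N &
    (forall x, ideal_pow (@arrow_ideal F n) r x -> I x) /\
    (forall x, I x -> ideal_pow (@arrow_ideal F n) 2 x).

(* The quotient FQ / I is given by a surjective algebra morphism from FQ with *)
(* kernel I.                                                                  *)
Definition is_LNakayama (F : fieldType) n (A : falgType F)
    (pi : {lrmorphism pathalg F n -> A}) : Prop :=
  (forall a : A, exists x, pi x = a) /\ admissible (fun x => pi x = 0).

Definition kupisch (F : fieldType) n (A : falgType F)
    (pi : {lrmorphism pathalg F n -> A}) (i : 'I_n.+1) : nat :=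
  \dim (<[pi (vertex_elt F i)]> * fullv)%VS.

Section Homological.
Variable R : pzRingType.
Implicit Types (M N P : lmodType R).

Definition surjective_fun (T U : Type) (f : T -> U) : Prop :=
  forall y, exists x, f x = y.

Definition projective P : Prop :=
  forall (M N : lmodType R) (g : {linear M -> N}) (f : {linear P -> N}),
    surjective_fun g -> exists h : {linear P -> M}, forall x, g (h x) = f x.

Record proj_resolution M := ProjResolution {
  pr_obj : nat -> lmodType R;
  pr_diff : forall i, {linear pr_obj i.+1 -> pr_obj i};
  pr_aug : {linear pr_obj 0 -> M};
  pr_projective : forall i, projective (pr_obj i);
  pr_aug_surj : surjective_fun pr_aug;
  pr_exact0 : forall x, pr_aug x = 0 <-> exists y, pr_diff 0 y = x;
  pr_exactS : forall i x, pr_diff i x = 0 <-> exists y, pr_diff i.+1 y = x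
}.

Definition pd_le M (d : nat) : Prop :=
  exists P : proj_resolution M,
    forall i, (d < i)%N -> forall x : pr_obj P i, x = 0.

(* pd(M) = d, for a nonzero module M.                                         *)
Definition pd_eq M (d : nat) : Prop :=
  pd_le M d /\ forall e, pd_le M e -> (d <= e)%N.

Definition is_submod M (U : M -> Prop) : Prop :=
  [/\ U 0, (forall x y, U x -> U y -> U (x + y))
    & (forall a x, U x -> U (a *: x))].

Definition is_simple M : Prop :=
  (exists x : M, x <> 0) /\
  forall U : M -> Prop, is_submod U ->
    (forall x, U x -> x = 0) \/ (forall x, U x).

End Homological.

(* Right A-modules are left modules over the opposite algebra A^c: the action *)
(* x.a is written (a : A^c) *: x.                                             *)
Notation rmodType A := (lmodType A^c).

Definition regular_rmod (F : fieldType) (A : falgType F) : rmodType A := (A^c)^o.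

Section Ext.
Variables (F : fieldType) (A : falgType F).
Implicit Types M N : rmodType A.

Definition fscale N (c : F) (x : N) : N := (c%:A : A^c) *: x.

(* dim_F Ext^1_A(M, N) = d: for a projective resolution P of M, some d        *)
(* 1-cocycles of Hom_A(P, N) form an F-basis of the 1-cocycles modulo the     *)
(* 1-coboundaries. This does not depend on P.                                 *)
Definition ext1_dim M N (d : nat) : Prop :=
  exists P : proj_resolution M,
  let cocycle (f : {linear pr_obj P 1 -> N}) :=
    forall x, f (pr_diff P 1 x) = 0 in
  exists phi : 'I_d -> {linear pr_obj P 1 -> N},
  [/\ forall i, cocycle (phi i),
      forall f, cocycle f ->
        exists (c : 'I_d -> F) (g : {linear pr_obj P 0 -> N}),
          forall x, f x = \sum_i fscale (c i) (phi i x) + g (pr_diff P 0 x)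
    & forall (c : 'I_d -> F) (g : {linear pr_obj P 0 -> N}),
        (forall x, \sum_i fscale (c i) (phi i x) = g (pr_diff P 0 x)) ->
        forall i, c i = 0].

Definition one_regular M : Prop :=
  [/\ pd_eq M 1,
      (forall (f : {linear M -> regular_rmod A}) x, f x = 0)
    & ext1_dim M (regular_rmod A) 1].

End Ext.

(* S is (isomorphic to) the simple right A-module S_i: it is simple and       *)
(* S.e_i <> 0.                                                                *)
Definition simple_at (F : fieldType) n (A : falgType F)
    (pi : {lrmorphism pathalg F n -> A}) (i : 'I_n.+1) (S : rmodType A) : Prop :=
  is_simple S /\ exists x : S, (pi (vertex_elt F i) : A^c) *: x <> 0.

(* Main.v *)
From HB Require Import structures.
Require Import Defs.
From mathcomp Require Import all_boot all_order all_algebra all_field zify.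

Set Implicit Arguments.
Unset Strict Implicit.
Unset Printing Implicit Defensive.

Import GRing.Theory.

(**
The algebra A has the nonzero paths i -> l, i <= l <= h_i, as a basis, where
h_i = i + c_i - 1. For k < n the simple module S_k has the projective cover
e_k A, whose radical alpha A (alpha the arrow k -> k+1) is a quotient of
e_{k+1} A. Hence pd S_k = 1 if and only if left multiplication by alpha is
injective on e_{k+1} A, i.e. h_{k+1} = h_k. In that case
0 -> e_{k+1} A -> e_k A -> S_k -> 0 is a resolution; Ext^1(S_k, A) is the
cokernel of A e_k -> A e_{k+1}, always spanned by the class of e_{k+1}, and
Hom(S_k, A) is its kernel, which vanishes if and only if no h_i equals k.

On the combinatorial side, every entry d_j with j >= 1 contributes one
horizontal and one vertical step to zeta(D), and both are the (k(j)+1)-st of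
their kind. So h_{k(j)} counts the horizontal steps preceding the vertical step
of j. As d_{j+1} <= d_j + 1, the vertical step of j is followed by a horizontal
one exactly when d_{j+1} = d_j + 1 (j is not a peak), and the horizontal step
of j is preceded by a vertical one exactly when j > 1 and d_j = d_{j-1} + 1.
*)

(** * Dyck paths and their coarea sequences *)

Lemma count_mem_catcons (b c : step) u w :
  count_mem b (u ++ c :: w) = count_mem b u + ((c == b) + count_mem b w).
Proof. by rewrite count_cat. Qed.

Lemma count_mem_cons (b c : step) w :
  count_mem b (c :: w) = (c == b) + count_mem b w.
Proof. by []. Qed.

Lemma count_mem_rcons (b c : step) u :
  count_mem b (rcons u c) = count_mem b u + (c == b).
Proof. by rewrite -cats1 count_cat /= addn0. Qed.

Lemma vstep_neq_hstep : (vstep == hstep = false) * (hstep == vstep = false).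
Proof. by []. Qed.

Lemma count_mem_nil (b : step) : count_mem b [::] = 0.
Proof. by []. Qed.

Definition count_step := (count_mem_catcons, count_mem_rcons, eqxx,
  (vstep_neq_hstep, count_mem_nil, addn0, add0n, addn1, add1n)).

Lemma xcoord_mono (D : seq step) i k : i <= k -> xcoord D i <= xcoord D k.
Proof.
by move=> ik; rewrite /xcoord -(subnKC ik) takeD count_cat leq_addr.
Qed.

Lemma ycoord_mono (D : seq step) i k : i <= k -> ycoord D i <= ycoord D k.
Proof.
by move=> ik; rewrite /ycoord -(subnKC ik) takeD count_cat leq_addr.
Qed.

Lemma xcoord_cat (u w : seq step) : xcoord (u ++ w) (size u) = count_mem vstep u.
Proof. by rewrite /xcoord take_size_cat. Qed.

Lemma ycoord_cat (u w : seq step) : ycoord (u ++ w) (size u) = count_mem hstep u.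
Proof. by rewrite /ycoord take_size_cat. Qed.

(** Both coordinates are monotone along the path, so the largest [y] on a vertical line is read just
    before the step that leaves it. *)
Lemma area_h_vstep (u w : seq step) :
  area_h (u ++ vstep :: w) (count_mem vstep u) = count_mem hstep u.
Proof.
set D := u ++ _; apply/eqP; rewrite eqn_leq; apply/andP; split.
  apply/bigmax_leqP => i /eqP xi.
  have iu : i <= size u.
    rewrite leqNgt; apply/negP => /(xcoord_mono D).
    rewrite xi /D -cat_rcons -(size_rcons u vstep) xcoord_cat !count_step.
    by lia.
  by rewrite (leq_trans (ycoord_mono D iu)) // ycoord_cat.
have ltu : size u < (size D).+1 by rewrite ltnS size_cat leq_addr.
apply: leq_trans (leq_bigmax_cond (Ordinal ltu) _) => /=; first by rewrite ycoord_cat.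
by rewrite xcoord_cat.
Qed.

Lemma bigminn_le (I : eqType) (r : seq I) (P : pred I) (F : I -> nat) x0 i :
  i \in r -> P i -> \big[minn/x0]_(k <- r | P k) F k <= F i.
Proof.
elim: r => // a r IHr; rewrite inE big_cons => /orP[/eqP-> -> | ir Pi].
  exact: geq_minl.
by case: ifP => _; rewrite ?(leq_trans (geq_minr _ _)) ?IHr.
Qed.

(** Dually, the smallest [x] at a given height is read right after the horizontal step that reaches
    it. *)
Lemma coarea_g_hstep (u w : seq step) :
  coarea_g (u ++ hstep :: w) (count_mem hstep u).+1 = count_mem vstep u.
Proof.
set D := u ++ _; apply/eqP; rewrite eqn_leq; apply/andP; split.
  have lti : (size u).+1 < (size D).+1 by rewrite ltnS size_cat /= -addSnnS leq_addr.
  have -> : count_mem vstep u = xcoord D (Ordinal lti).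
    by rewrite /= /D -cat_rcons -(size_rcons u hstep) xcoord_cat !count_step.
  apply: bigminn_le; first exact: mem_index_enum.
  by rewrite /= /D -cat_rcons -(size_rcons u hstep) ycoord_cat !count_step.
rewrite /coarea_g; apply: (big_ind (leq (count_mem vstep u))).
(* The default [size D] of the minimum must obey the bound as well. *)
- by rewrite (leq_trans (count_size _ _)) // size_cat leq_addr.
- by move=> a b ua ub; rewrite leq_min ua ub.
move=> i /eqP yi; rewrite -(xcoord_cat u (hstep :: w)); apply: xcoord_mono.
rewrite leqNgt; apply/negP => /ltnW /(ycoord_mono D).
by rewrite yi ycoord_cat ltnn.
Qed.

Lemma hstep_split (D : seq step) y : y < count_mem hstep D ->
  exists u w, D = u ++ hstep :: w /\ count_mem hstep u = y.
Proof.
elim: D y => // -[] D IHD [|y] /= ltyD.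
- by exists [::], D.
- have [u [w [-> <-]]] := IHD y ltyD.
  by exists (hstep :: u), w.
- have [u [w [-> cu]]] := IHD 0 ltyD.
  by exists (vstep :: u), w; rewrite /= cu.
- have [u [w [-> cu]]] := IHD y.+1 ltyD.
  by exists (vstep :: u), w; rewrite /= cu.
Qed.

(** For a coarea sequence this is the absence of a peak at height [j]; the guard [j < n] makes the
    last entry non-rising. *)
Definition rising n (d : nat -> nat) j := (j < n) && (d j.+1 == (d j).+1).

Section DyckPath.
Variables (n : nat) (D : seq step).
Hypothesis dyckD : is_dyck n D.

Lemma dyck_prefix u w : D = u ++ w -> count_mem vstep u <= count_mem hstep u.
Proof.
have [_ _ leD] := dyckD => defD; have := leD (size u).
by rewrite defD xcoord_cat ycoord_cat size_cat leq_addr; apply.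
Qed.

Lemma dyck_hstep_split j : 0 < j <= n -> exists u w,
  [/\ D = u ++ hstep :: w, (count_mem hstep u).+1 = j, count_mem vstep u < j & w <> [::]].
Proof.
move=> /andP[j0 jn]; have [xn yn leD] := dyckD.
have [|u [w [defD cu]]] := @hstep_split D j.-1.
  by move: yn; rewrite /ycoord take_size => ->; lia.
have ltu := dyck_prefix defD.
exists u, w; split=> //; try lia.
(* A path ending with this step would stop at an [x]-coordinate below [j <= n]. *)
move=> w0; move: xn; rewrite /xcoord take_size defD w0 !count_step => xn; lia.
Qed.

Lemma coarea_split u w j : D = u ++ hstep :: w -> (count_mem hstep u).+1 = j ->
  coarea D j = (j - count_mem vstep u).+1.
Proof. by move=> -> <-; rewrite /coarea coarea_g_hstep. Qed.

Lemma coarea0 : coarea D 0 = 1.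
Proof. by rewrite /coarea sub0n. Qed.

Lemma coarea_ge2 j : 0 < j <= n -> 1 < coarea D j.
Proof.
move=> /dyck_hstep_split[u [w [defD cu lt_uj _]]].
by rewrite (coarea_split defD cu); lia.
Qed.

(** Here [g] is the number of vertical steps between the horizontal steps numbered [j] and [j.+1],
    and [g = 0] means that these are adjacent. *)
Lemma coareaSE u w j : D = u ++ hstep :: w -> (count_mem hstep u).+1 = j ->
  j < n -> count_mem vstep u < j ->
  exists g, coarea D j.+1 = (j.+1 - (count_mem vstep u + g)).+1 /\
    (g == 0) = (head vstep w == hstep).
Proof.
move=> defD cu ltjn ltu.
have /dyck_hstep_split[u' [w' [defD' cu' _ _]]] : 0 < j.+1 <= n by [].
have [|a [b [defw ca]]] := @hstep_split w 0.
  move: (congr1 (count_mem hstep) defD) (congr1 (count_mem hstep) defD').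
  by rewrite !count_step; lia.
exists (count_mem vstep a); split.
  have defD2 : D = (u ++ hstep :: a) ++ hstep :: b by rewrite -catA /= -defw.
  rewrite (coarea_split defD2 (j := j.+1)).
    by rewrite !count_step; lia.
  by rewrite !count_step; lia.
rewrite defw; case: (a) ca => [|[] a'] //=.
Qed.

Lemma coareaS j : j < n -> coarea D j.+1 <= (coarea D j).+1.
Proof.
case: j => [|j] ltjn; first by rewrite coarea0 /coarea; lia.
have /dyck_hstep_split[u [w [defD cu ltu _]]] : 0 < j.+1 <= n by lia.
have [g [-> _]] := coareaSE defD cu ltjn ltu.
by rewrite (coarea_split defD cu); lia.
Qed.

Lemma coareaS_rise u w j : D = u ++ hstep :: w -> (count_mem hstep u).+1 = j ->
  j < n -> count_mem vstep u < j ->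
  (coarea D j.+1 == (coarea D j).+1) = (head vstep w == hstep).
Proof.
move=> defD cu ltjn ltu; have [g [-> <-]] := coareaSE defD cu ltjn ltu.
by rewrite (coarea_split defD cu); lia.
Qed.

Lemma rising_split u w j : 0 < j <= n -> D = u ++ hstep :: w ->
  (count_mem hstep u).+1 = j -> count_mem vstep u < j -> w <> [::] ->
  rising n (coarea D) j = (head vstep w == hstep).
Proof.
move=> j_gt0 defD cu ltu w0; rewrite /rising; case: ltnP => [ltjn|lenj] /=.
  by rewrite (coareaS_rise defD cu).
(* For [j = n] no horizontal step is left, so the nonempty rest starts with a vertical one. *)
have [_ yn _] := dyckD; move: yn; rewrite /ycoord take_size defD !count_step => yn.
case: (w) w0 yn => [|[] w2] // _; rewrite count_mem_cons !count_step => yn //=; lia.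
Qed.

Lemma take_hstep_split i : i < size D -> nth vstep D i = hstep ->
  D = take i D ++ hstep :: drop i.+1 D.
Proof. by move=> ltiD Di; rewrite -[in LHS](cat_take_drop i D) (drop_nth vstep) ?Di. Qed.

Lemma take_hstep_facts i : i < size D -> nth vstep D i = hstep ->
  [/\ 0 < ycoord D i.+1 <= n, (count_mem hstep (take i D)).+1 = ycoord D i.+1,
   count_mem vstep (take i D) < ycoord D i.+1 & drop i.+1 D <> [::]].
Proof.
move=> ltiD Di; have [xn yn leD] := dyckD.
have yi : ycoord D i.+1 = (ycoord D i).+1.
  by rewrite /ycoord (take_nth vstep) // Di !count_step.
have ltx : xcoord D i < ycoord D i.+1 by rewrite yi ltnS leD // ltnW.
have leyn : ycoord D i.+1 <= n by rewrite -yn ycoord_mono.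
split=> //; first by rewrite yi in leyn *.
move=> d0; move: xn; rewrite /xcoord take_size {1}(take_hstep_split ltiD Di) d0.
rewrite !count_step => xn; move: ltx leyn; rewrite /xcoord; lia.
Qed.

Lemma has_peakP j : 0 < j <= n -> has_peak D j <-> ~~ rising n (coarea D) j.
Proof.
move=> j_bd; split.
  case=> i [ltiD Di Di1 yi].
  have [_ cu ltu w0] := take_hstep_facts (ltnW ltiD) Di.
  rewrite yi in cu ltu.
  rewrite (rising_split j_bd (take_hstep_split (ltnW ltiD) Di)) //.
  by rewrite (drop_nth hstep) // Di1.
have [u [w [defD cu ltu w0]]] := dyck_hstep_split j_bd.
rewrite (rising_split j_bd defD cu ltu w0) => hw.
case: w w0 hw defD => [|[] w] // _ _ defD.
exists (size u); rewrite defD size_cat /=; split.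
- by rewrite -addn2 leq_add2l.
- by rewrite nth_cat ltnn subnn.
- by rewrite nth_cat ltnNge leqnSn subSnn.
by rewrite -cat_rcons -(size_rcons u hstep) ycoord_cat !count_step.
Qed.

(** The two conditions exclude a horizontal successor and a horizontal predecessor. The guard
    [1 < j] matters: [d 1 = d 0 + 1] always holds, although no step precedes the first one. *)
Lemma has_one_riseP j : 0 < j <= n ->
  has_one_rise D j <-> ~~ rising n (coarea D) j /\ ~ (1 < j /\ coarea D j = (coarea D j.-1).+1).
Proof.
move=> j_bd; split.
  case=> i [[ltiD Di] yi Dp Dn].
  have [_ cu ltu w0] := take_hstep_facts ltiD Di; rewrite yi in cu ltu.
  have defD := take_hstep_split ltiD Di.
  split.
    rewrite (rising_split j_bd defD) //.
    case: (ltnP i.+1 (size D)) => [lti1|]; last by move/drop_oversize.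
    rewrite (drop_nth vstep) //=; apply/eqP => Di1; exact: Dn.
  case=> j_gt1 dj; case: i => [|i] in ltiD Di yi Dp Dn cu ltu w0 defD *.
    by move: yi; rewrite /ycoord (take_nth vstep) // Di take0 /=; lia.
  case: Dp; split=> //=; have ltiD' := ltnW ltiD.
  have jE : j = j.-1.+1 by lia.
  have /dyck_hstep_split[u [w [defD' cu' ltu' w0']]] : 0 < j.-1 <= n by lia.
  have := coareaS_rise defD' cu'; rewrite -jE dj eqxx => /(_ _ ltu')/esym hw.
  case: w hw w0' defD' => [|[] w] hw // _ defD'; first last.
    by move: hw; rewrite /=; lia.
  (* Monotonicity of the height locates the [j]-th horizontal step directly after the previous one,
     which has position [size u]. *)
  have iE : i.+1 = (size u).+1.
    apply/eqP; rewrite eqn_leq; apply/andP; split.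
      rewrite leqNgt; apply/negP => lti.
      have := ycoord_mono D lti.
      rewrite [in X in X <= _]defD' -!cat_rcons.
      rewrite -(size_rcons u hstep) -(size_rcons (rcons u hstep) hstep) ycoord_cat.
      rewrite !count_step; move: cu; rewrite -/(ycoord _ _); lia.
    rewrite leqNgt; apply/negP; rewrite ltnS => /(ycoord_mono D).
    by rewrite [in X in _ <= X]defD' ycoord_cat; move: cu; rewrite -/(ycoord _ _); lia.
  by case: iE => ->; rewrite defD' nth_cat ltnn subnn.
case=> rj nj; have [u [w [defD cu ltu w0]]] := dyck_hstep_split j_bd.
move: rj; rewrite (rising_split j_bd defD cu ltu w0) => hw.
case: w w0 hw defD => [|[] w] // _ _ defD.
exists (size u); split.
- by rewrite defD size_cat /= nth_cat ltnn subnn addnS ltnS leq_addr.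
- rewrite defD -cat_rcons -(size_rcons u hstep) ycoord_cat !count_step; lia.
- case=> u0 Du; apply: nj.
  case: (lastP u) u0 Du cu ltu defD => [|u' x] // _ Du cu ltu defD.
  move: Du; rewrite size_rcons {1}defD nth_cat size_rcons ltnSn nth_rcons ltnn eqxx => xh.
  have defD' : D = u' ++ hstep :: (hstep :: vstep :: w) by rewrite defD cat_rcons xh.
  move: cu ltu; rewrite xh !count_step => cu ltu; split; first lia.
  have := coareaS_rise (j := j.-1) defD'; rewrite prednK; last lia.
  have := dyck_prefix defD'; move=> leu H.
  by apply/eqP; rewrite H //; lia.
by case=> _; rewrite defD nth_cat ltnNge leqnSn subSnn.
Qed.

End DyckPath.

(** * The zeta map *)

Lemma sub_in_count (T : eqType) (a b : pred T) (s : seq T) :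
  {in s, subpred a b} -> count a s <= count b s.
Proof.
elim: s => //= y s IHs ab; apply: leq_add.
  by case ay: (a y) => //; rewrite (ab y) ?mem_head.
by apply: IHs => x xs; apply: ab; rewrite inE xs orbT.
Qed.

Lemma ltn_in_count (T : eqType) (a b : pred T) (s : seq T) x :
  {in s, subpred a b} -> x \in s -> ~~ a x -> b x -> count a s < count b s.
Proof.
elim: s => // y s IHs ab; rewrite inE => xs nax bx /=.
have ab' : {in s, subpred a b} by move=> z zs; apply: ab; rewrite inE zs orbT.
case/orP: xs => [/eqP<-|xs].
  by rewrite (negbTE nax) bx add0n add1n ltnS sub_in_count.
rewrite -addnS leq_add ?IHs //.
by case ay: (a y) => //; rewrite (ab y) ?mem_head.
Qed.

(** * Ranks of the entries in the lexicographic order of zeta *)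

Section SlowSequence.
Variables (n : nat) (d : nat -> nat).

(* [vbefore i j] and [hbefore i j]: the vertical, resp. horizontal, step that
   the entry [d i] contributes to the image under zeta precedes the vertical
   step contributed by [d j]. *)
Definition vbefore i j := (d i < d j) || ((d i == d j) && (i < j)).
Definition hbefore i j := (d i <= d j) || ((d i == (d j).+1) && (i < j)).

(** By [zeta_split], [vrank] and [hrank] are the coordinates of the point where the vertical step of
    [j] starts. *)
Definition vrank j := count (vbefore^~ j) (iota 1 n).
Definition hrank j := count (hbefore^~ j) (iota 1 n).

Lemma ltn_vrank i j : 0 < i <= n -> vbefore i j -> vrank i < vrank j.
Proof.
move=> i_bd vij; apply: (@ltn_in_count _ _ _ _ i) => //.
- by move=> l _; move: vij; rewrite /vbefore; lia.
- by rewrite mem_iota; lia.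
by rewrite /vbefore; lia.
Qed.

Lemma vbeforeP i j : 0 < i <= n -> 0 < j <= n -> vbefore i j = (vrank i < vrank j).
Proof.
move=> i_bd j_bd; apply/idP/idP => [|ltij]; first exact: ltn_vrank.
apply: contraLR ltij => nvij; rewrite -leqNgt.
have [->//|nij] := eqVneq i j; apply: ltnW; apply: ltn_vrank => //.
by move: nvij nij; rewrite /vbefore; lia.
Qed.

Lemma vrank_inj i j : 0 < i <= n -> 0 < j <= n -> vrank i = vrank j -> i = j.
Proof.
move=> i_bd j_bd eij; have := vbeforeP i_bd j_bd; have := vbeforeP j_bd i_bd.
by rewrite eij ltnn /vbefore; lia.
Qed.

Lemma vrank_lt j : 0 < j <= n -> vrank j < n.
Proof.
move=> j_bd; rewrite -[X in _ < X](size_iota 1 n) -(count_predT (iota 1 n)).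
apply: (@ltn_in_count _ _ _ _ j) => //; first by rewrite mem_iota; lia.
by rewrite /vbefore; lia.
Qed.

(** Pigeonhole: [vrank] is injective from [n] entries into the numbers below [n]. *)
Lemma vrank_onto k : k < n -> exists2 j, 0 < j <= n & vrank j = k.
Proof.
move=> ltkn; have us : uniq [seq vrank j | j <- iota 1 n].
  rewrite map_inj_in_uniq ?iota_uniq // => i j; rewrite !mem_iota => i_bd j_bd.
  by apply: vrank_inj; lia.
have [||_ eqs] := uniq_min_size us (s2 := iota 0 n).
- move=> _ /mapP[j j_bd ->]; rewrite mem_iota /= vrank_lt //.
  by move: j_bd; rewrite mem_iota; lia.
- by rewrite size_map !size_iota.
have : k \in iota 0 n by rewrite mem_iota.
rewrite -eqs => /mapP[j]; rewrite mem_iota => j_bd ->.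
by exists j => //; lia.
Qed.

(** The entry [j] makes the inequality strict: its horizontal step precedes its own vertical
    step. *)
Lemma vrank_lt_hrank j : 0 < j <= n -> vrank j < hrank j.
Proof.
move=> j_bd; apply: (@ltn_in_count _ _ _ _ j).
- by move=> l _; rewrite /vbefore /hbefore; lia.
- by rewrite mem_iota; lia.
- by rewrite /vbefore; lia.
by rewrite /hbefore; lia.
Qed.

(** The horizontal step of [j.+1] comes after the vertical step of [j] and before that of [j']. *)
Lemma rising_hrank j j' : 0 < j <= n -> 0 < j' <= n -> rising n d j ->
  vrank j < vrank j' -> hrank j < hrank j'.
Proof.
move=> j_bd j'_bd /andP[ltjn /eqP dj]; rewrite -vbeforeP // => vjj'.
apply: (@ltn_in_count _ _ _ _ j.+1).
- by move=> l _; move: vjj'; rewrite /vbefore /hbefore; lia.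
- by rewrite mem_iota; lia.
- by rewrite /hbefore; lia.
have [ej|nej] := eqVneq j' j.+1; move: vjj'; rewrite /vbefore /hbefore.
  by rewrite ej; lia.
lia.
Qed.

Lemma rising_vrank j : 0 < j <= n -> rising n d j -> (vrank j).+1 < n.
Proof.
move=> j_bd /andP[ltjn /eqP dj].
have j1_bd : 0 < j.+1 <= n by lia.
by apply: leq_trans (vrank_lt j1_bd); rewrite ltnS ltn_vrank // /vbefore; lia.
Qed.

(** Under this hypothesis [hbefore i j.-1] and [vbefore i j] are the same condition: they could
    differ only at [i = j.-1], whose value lies below [d j]. *)
Lemma hrank_pred j : 1 < j <= n -> d j = (d j.-1).+1 -> hrank j.-1 = vrank j.
Proof.
move=> j_bd dj; apply: eq_in_count => l _; rewrite /hbefore /vbefore.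
have [->|nlj] := eqVneq l j.-1; lia.
Qed.

Hypotheses (d0 : d 0 = 1) (d_ge2 : forall j, 0 < j <= n -> 1 < d j).
Hypothesis (dS : forall j, j < n -> d j.+1 <= (d j).+1).

(** A discrete intermediate value theorem, valid upwards only: [d] rises by at most one but may drop
    by any amount. *)
Lemma slow_ivt a b v : a <= b <= n -> d a <= v <= d b ->
  exists2 l, a <= l <= b & d l = v.
Proof.
move=> /andP[ab]; elim: b ab => [|b IHb].
  by rewrite leqn0 => /eqP-> _ dv; exists 0; lia.
rewrite leq_eqVlt => /orP[/eqP<- _|ltab ltbn] dv; first by exists a; lia.
have [dbv|vdb] := leqP v (d b).
  by have [|||l lb dl] := IHb => //; [lia|lia|exists l => //; lia].
by exists b.+1; first lia; have := dS ltbn; lia.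
Qed.

(* If an entry i separates j from its successor j', then some earlier
   entry with value [d i - 1] lies strictly between j and j'. *)
Lemma nrising_hrank j j' : 0 < j <= n -> 0 < j' <= n -> ~~ rising n d j ->
  vrank j' = (vrank j).+1 -> hrank j' <= hrank j.
Proof.
move=> j_bd j'_bd nrj vj'; apply: sub_in_count => i.
rewrite mem_iota => i_bd hij'; apply: contraT => nhij.
(* Such an [l] would have a rank strictly between two consecutive numbers. *)
suff [l l_bd /andP[vjl vlj']] : exists2 l, 0 < l <= n & vbefore j l && vbefore l j'.
  by move: vjl vlj'; rewrite !vbeforeP //; lia.
have dj := d_ge2 j_bd.
have [ltdi|ledi] := ltnP (d j).+1 (d i).
  (* Interpolation from [d 0 = 1] finds the value [d i - 1], still above [d j], before [i]. *)
  have [||l l_bd dl] := @slow_ivt 0 i (d i).-1; [lia|lia|].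
  have l0 : l != 0 by apply: contraTneq isT => l0; move: dl; rewrite l0 d0; lia.
  have li : l != i by apply: contraTneq isT => li; move: dl; rewrite li; lia.
  exists l; first lia.
  by move: hij'; rewrite /vbefore /hbefore dl; lia.
have dij : d i = (d j).+1 by move: nhij; rewrite /hbefore; lia.
have ltji : j < i.
  have [ij|nij] := eqVneq i j; first by move: dij; rewrite ij; lia.
  by move: nhij; rewrite /hbefore dij; lia.
have ltjn : j < n by lia.
have dj1 : d j.+1 <= d j.
  by move: nrj (dS ltjn); rewrite /rising ltjn /=; lia.
(* As [j] is not rising, interpolation can start at [j.+1], which puts [l] after [j] with the same
   value. *)
have [||l l_bd dl] := @slow_ivt j.+1 i (d j); [lia|lia|].
have li : l != i by apply: contraTneq isT => li; move: dl; rewrite li; lia.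
exists l; first lia.
by move: hij'; rewrite /vbefore /hbefore dl; lia.
Qed.

(* Both ranks count initial segments of the same lexicographic order, so equal
   ranks force equal segments. *)
Lemma hrank_neq_vrank i j : 0 < i <= n -> 0 < j <= n ->
  ~ (1 < j /\ d j = (d j.-1).+1) -> hrank i <> vrank j.
Proof.
move=> i_bd j_bd nj hv; have di := d_ge2 i_bd.
(* Otherwise the segment counted by [hrank i] contains the one counted by [vrank j] and also [j]
   itself. *)
have nhji : ~~ hbefore j i.
  apply/negP => hji; suff : vrank j < hrank i by rewrite hv ltnn.
  apply: (@ltn_in_count _ _ _ _ j) => //.
  - by move=> l _; move: hji; rewrite /vbefore /hbefore; lia.
  - by rewrite mem_iota; lia.
  by rewrite /vbefore; lia.
have dij : d i < d j.
  have [ij|nij] := eqVneq i j; first by move: nhji; rewrite ij /hbefore; lia.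
  by move: nhji; rewrite /hbefore; lia.
have j1 : 1 < j.
  case: ltnP => // j1; have {}j1 : j = 1 by lia.
  by have := dS (j := 0); rewrite d0 -j1; lia.
have dj : d j <= d j.-1.
  have jE : j.-1.+1 = j by lia.
  by have := dS (j := j.-1); rewrite jE; lia.
(* The segment of [hrank i] now lies inside that of [vrank j]. An earlier entry [l] with the value
   of [d j] makes this inclusion strict; the implication keeps [l] out of the smaller segment. *)
have [l /andP[l_bd lij] dl] :
    exists2 l, (0 < l < j) && ((d j == (d i).+1) ==> (i <= l)) & d l = d j.
  have [dji|ndji] := eqVneq (d j) (d i).+1 => /=.
    have ltij : i < j.
      have [ij|nij] := eqVneq i j; first by move: dij; rewrite ij; lia.
      by move: nhji; rewrite /hbefore; lia.
    have [||l l_bd dl] := @slow_ivt i j.-1 (d j); [lia|lia|].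
    by exists l => //; lia.
  have [||l l_bd dl] := @slow_ivt 0 j.-1 (d j); [lia|lia|].
  have l0 : l != 0 by apply: contraTneq isT => l0; move: dl; rewrite l0 d0; lia.
  by exists l => //; lia.
suff : hrank i < vrank j by rewrite hv ltnn.
apply: (@ltn_in_count _ _ _ _ l).
- by move=> m _; move: nhji; rewrite /vbefore /hbefore; lia.
- by rewrite mem_iota; lia.
- by rewrite /hbefore; lia.
by rewrite /vbefore; lia.
Qed.

End SlowSequence.

Lemma card_set_ord (P : pred nat) m : #|[set i : 'I_m | P i]| = count P (iota 0 m).
Proof. by rewrite cardsE cardE size_filter -val_enum_ord count_map -enumT. Qed.

Lemma count_disjointU (T : eqType) (a b c : pred T) (s : seq T) :
  {in s, forall x, (c x : nat) = a x + b x} -> count c s = count a s + count b s.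
Proof.
elim: s => //= x s IHs abc; rewrite IHs; last first.
  by move=> y ys; apply: abc; rewrite inE ys orbT.
by rewrite abc ?mem_head // addnACA.
Qed.

Lemma count_vstep_zeta_word s k : count_mem vstep (zeta_word s k) = count_mem k s.
Proof.
rewrite /zeta_word count_map count_filter; apply: eq_in_count => x _ /=.
by case: (eqVneq x k).
Qed.

Lemma count_hstep_zeta_word s k : count_mem hstep (zeta_word s k) = count_mem k.+1 s.
Proof.
rewrite /zeta_word count_map count_filter; apply: eq_in_count => x _ /=.
by case: (eqVneq x k) => [->|] /=; lia.
Qed.

Lemma zeta_word_cat s t k : zeta_word (s ++ t) k = zeta_word s k ++ zeta_word t k.
Proof. by rewrite /zeta_word filter_cat map_cat. Qed.

Section Zeta.
Variables (n : nat) (D : seq step).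
Hypothesis dyckD : is_dyck n D.

Local Notation d := (coarea D).
Local Notation s := [seq d i | i <- iota 1 n].

(** The index [0] has value 1, below [d j], so it is counted exactly once; the final [- 1] in
    [kindex] removes it. *)
Lemma kindexE j : 0 < j <= n -> kindex n D j = vrank n d j.
Proof.
move=> j_bd; have dj := coarea_ge2 dyckD j_bd.
rewrite /kindex (card_set_ord (fun i => d i < d j)).
rewrite (card_set_ord (fun i => (i < j) && (d i == d j))) /= coarea0 dj.
rewrite (_ : 1 == d j = false) ?andbF; last by lia.
rewrite -addnA add1n subn1 /= add0n /vrank; apply/esym/count_disjointU => i _.
by rewrite /vbefore; lia.
Qed.

(** Induction on [e]: the word for [k] has a vertical step per entry [k] and a horizontal step per
    entry [k.+1]. The entries 2 have their horizontal steps in the initial block of zeta, hence the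
    extra summand. *)
Lemma count_flatten_zeta_words e : 1 < e ->
  let u := flatten [seq zeta_word s k | k <- index_iota 2 e] in
  count_mem vstep u = count (fun i => d i < e) (iota 1 n) /\
  count_mem hstep u + count (fun i => d i == 2) (iota 1 n)
    = count (fun i => d i <= e) (iota 1 n).
Proof.
case: e => [|[|e]] //= _; elim: e => [|e [IHv IHh]].
  rewrite /index_iota subnn /= add0n; split; last first.
    apply: eq_in_count => i; rewrite mem_iota => i_bd.
    by have := coarea_ge2 dyckD (j := i); lia.
  apply/esym/eqP; rewrite -leqn0 leqNgt -has_count; apply/hasPn => i.
  by rewrite mem_iota => i_bd; have := coarea_ge2 dyckD (j := i); lia.
have -> : index_iota 2 e.+3 = index_iota 2 e.+2 ++ [:: e.+2].
  rewrite /index_iota (_ : e.+3 - 2 = (e.+2 - 2) + 1); last lia.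
  by rewrite iotaD subnKC.
rewrite map_cat flatten_cat /= cats0 !count_cat count_vstep_zeta_word.
rewrite count_hstep_zeta_word IHv addnAC IHh !count_map.
by split; apply/esym/count_disjointU => i _ /=; lia.
Qed.

(** The word is cut at the vertical step of [j]: [u] is the initial block, the words for values
    below [d j], and the part of the word for [d j] coming from entries before [j]. *)
Lemma zeta_split j : 0 < j <= n -> exists u w,
  [/\ zeta n D = u ++ vstep :: w, count_mem vstep u = vrank n d j
    & count_mem hstep u = hrank n d j].
Proof.
move=> j_bd; have dj := coarea_ge2 dyckD j_bd.
set m := \max_(i < n.+1) d i.
have lt_jn : j < n.+1 by lia.
have le_djm : d j <= m by exact: (leq_bigmax (Ordinal lt_jn)).
have [cv ch] := count_flatten_zeta_words dj.
have e1 : index_iota 2 m.+1 = index_iota 2 (d j) ++ d j :: index_iota (d j).+1 m.+1.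
  rewrite /index_iota (_ : m.+1 - 2 = (d j - 2) + (m - d j).+1); last lia.
  by rewrite iotaD subnKC //= subSS.
have e2 : iota 1 n = iota 1 j.-1 ++ j :: iota j.+1 (n - j).
  rewrite [in LHS](_ : n = j.-1 + (n - j).+1); last lia.
  by rewrite iotaD /= (_ : 1 + j.-1 = j) //; lia.
pose u := nseq (count (fun i => d i == 2) (iota 1 n)) hstep
  ++ flatten [seq zeta_word s k | k <- index_iota 2 (d j)]
  ++ zeta_word [seq d i | i <- iota 1 j.-1] (d j).
exists u, (zeta_word [seq d i | i <- iota j.+1 (n - j)] (d j)
  ++ flatten [seq zeta_word s k | k <- index_iota (d j).+1 m.+1]).
split.
- rewrite /zeta -/m (card_set_ord (fun i => d i == 2)).
  (* The initial block is counted from index [0], where [d 0 = 1] contributes nothing. *)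
  rewrite -[count _ (iota 0 n.+1)]/((d 0 == 2) + count (fun i => d i == 2) (iota 1 n)).
  rewrite coarea0 add0n.
  rewrite e1 map_cat flatten_cat /= [zeta_word s (d j)](_ : _ =
    zeta_word [seq d i | i <- iota 1 j.-1] (d j) ++
    vstep :: zeta_word [seq d i | i <- iota j.+1 (n - j)] (d j)).
    by rewrite /u -!catA.
  rewrite e2 map_cat zeta_word_cat; congr (_ ++ _).
  by rewrite /zeta_word /= eqxx /= eqxx.
- rewrite /u !count_cat count_nseq /= mul0n add0n cv count_vstep_zeta_word count_map.
  rewrite /vrank [RHS](@count_disjointU _ (fun i => d i < d j)
    (fun i => (d i == d j) && (i < j))).
    congr (_ + _); rewrite e2 count_cat /= eqxx ltnn /= add0n.
    rewrite [X in _ = _ + X](_ : _ = 0) ?addn0; last first.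
      apply/eqP; rewrite -leqn0 leqNgt -has_count; apply/hasPn => i.
      by rewrite mem_iota; lia.
    by apply: eq_in_count => i; rewrite mem_iota /=; lia.
  by move=> i _; rewrite /vbefore; lia.
rewrite /u !count_cat count_nseq /= mul1n addnA [X in X + _]addnC ch.
rewrite count_hstep_zeta_word count_map.
rewrite /hrank [RHS](@count_disjointU _ (fun i => d i <= d j)
  (fun i => (d i == (d j).+1) && (i < j))).
  congr (_ + _); rewrite e2 count_cat /= ltnn andbF /= add0n.
  rewrite [X in _ = _ + X](_ : _ = 0) ?addn0; last first.
    apply/eqP; rewrite -leqn0 leqNgt -has_count; apply/hasPn => i.
    by rewrite mem_iota; lia.
  by apply: eq_in_count => i; rewrite mem_iota /=; lia.
by move=> i _; rewrite /hbefore; lia.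
Qed.

Lemma area_h_zeta j : 0 < j <= n -> area_h (zeta n D) (vrank n d j) = hrank n d j.
Proof. by case/zeta_split=> u [w [-> <- <-]]; apply: area_h_vstep. Qed.

Local Notation h := (area_h (zeta n D)).

Lemma ltn_area_h_zeta k : k < n -> k < h k.
Proof.
move=> lt_kn; have [j j_bd <-] := vrank_onto d lt_kn.
by rewrite area_h_zeta // vrank_lt_hrank.
Qed.

(** The entry of the next rank decides: a horizontal step separates the two vertical steps exactly
    when [j] is rising. If [k.+1 = n], there is no next entry and [j] cannot be rising by
    [rising_vrank]. *)
Lemma peak_zeta j : 0 < j <= n ->
  has_peak D j <-> let k := kindex n D j in (k.+1 < n -> h k.+1 <= h k).
Proof.
move=> j_bd; rewrite (has_peakP dyckD j_bd) kindexE //; split=> [nrj /= lt_k1n|].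
  have [j' j'_bd vj'] := vrank_onto d lt_k1n.
  rewrite -vj' !area_h_zeta //.
  by apply: (nrising_hrank (coarea0 D) (coarea_ge2 dyckD) (coareaS dyckD)).
move=> /= hk; apply/negP => rj.
have lt_k1n := rising_vrank j_bd rj.
have [j' j'_bd vj'] := vrank_onto d lt_k1n.
move: (hk lt_k1n); rewrite -vj' !area_h_zeta // leqNgt => /negP; apply.
by apply: rising_hrank => //; rewrite vj'.
Qed.

Lemma one_rise_zeta j : 0 < j <= n ->
  has_one_rise D j <-> has_peak D j /\ let k := kindex n D j in
     (forall i, i <= k -> h i <> k).
Proof.
move=> j_bd; rewrite (has_peakP dyckD j_bd) (has_one_riseP dyckD j_bd) kindexE //=.
split=> -[nrj hj]; split=> //.
  move=> i le_ik; have lt_in : i < n by apply: leq_ltn_trans le_ik (vrank_lt _ j_bd).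
  have [l l_bd <-] := vrank_onto d lt_in.
  rewrite area_h_zeta //.
  exact: (hrank_neq_vrank (coarea0 D) (coarea_ge2 dyckD) (coareaS dyckD)).
move=> [lt1j dj]; have j1_bd : 0 < j.-1 <= n by lia.
apply: (hj (vrank n d j.-1)).
  by apply/ltnW/ltn_vrank => //; rewrite /vbefore; lia.
by rewrite area_h_zeta // hrank_pred //; lia.
Qed.

End Zeta.

Local Open Scope ring_scope.

(** * Projective resolutions *)

Lemma linear_map_ex (R : pzRingType) (U V : lmodType R) (f : U -> V) :
  linear f -> {g : {linear U -> V} | g =1 f}.
Proof.
move=> lf.
pose L := GRing.isLinear.Build R U V *:%R f lf.
pose g : {linear U -> V} := HB.pack f L.
by exists g.
Qed.

Section Resolutions.
Variable R : pzRingType.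
Implicit Types M N P Q : lmodType R.

Lemma projective0 P : (forall x : P, x = 0) -> projective P.
Proof.
move=> P0 M N g f _; exists (\0 : {linear P -> M}) => x.
by rewrite (P0 x) !linear0.
Qed.

Section Short.
Variables (M P0 P1 : lmodType R) (d : {linear P1 -> P0}) (eps : {linear P0 -> M}).
Hypotheses (proj0 : projective P0) (proj1 : projective P1).
Hypotheses (eps_surj : surjective_fun eps).
Hypothesis exact0 : forall x, eps x = 0 <-> exists y, d y = x.
Hypothesis d_inj : forall y, d y = 0 -> y = 0.

Definition short_obj (i : nat) : lmodType R :=
  match i with 0 => P0 | 1 => P1 | _ => 'rV[R]_0 end%N.

Definition short_diff (i : nat) : {linear short_obj i.+1 -> short_obj i} :=
  match i return {linear short_obj i.+1 -> short_obj i} with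
  | 0 => d | 1 => \0 | _ => \0 end%N.

Lemma short_projective i : projective (short_obj i).
Proof.
case: i => [|[|i]] //=; apply: projective0 => x; exact: thinmx0.
Qed.

Lemma short_exactS i x :
  short_diff i x = 0 <-> exists y, short_diff i.+1 y = x.
Proof.
case: i x => [|i] x /=; split.
- by move=> /d_inj ->; exists 0.
- by case=> y <-; rewrite linear0.
- by move=> _; exists 0; rewrite [x]thinmx0 [LHS]thinmx0.
by case: i x => [|i] x _.
Qed.

Definition short_resolution : proj_resolution M :=
  @ProjResolution R M short_obj short_diff eps short_projective eps_surj
    exact0 short_exactS.

Lemma pd_le_short : pd_le M 1.
Proof.
by exists short_resolution => -[|[|i]] //= _ x; apply: thinmx0.
Qed.

End Short.

(* Choice-free forms of "M is projective" and of Schanuel's lemma: instead of a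
   section of g, they produce a preimage whose annihilator is as large as
   possible. *)
Lemma pd_le0_lift M P (g : {linear P -> M}) (y : M) : pd_le M 0 ->
  surjective_fun g -> exists2 t, g t = y & forall a, a *: y = 0 -> a *: t = 0.
Proof.
case=> Q Q0 g_surj.
have [h gh] := @pr_projective _ _ Q 0 _ _ g (pr_aug Q) g_surj.
have [q aq] := @pr_aug_surj _ _ Q y.
exists (h q) => [|a ay]; first by rewrite gh.
have /pr_exact0[z dz] : pr_aug Q (a *: q) = 0 by rewrite linearZ /= aq.
by rewrite -linearZ /= -dz (Q0 1%N isT z) !linear0.
Qed.

(** Comparison maps [u] and [v] between [P] and degree 0 of the resolution [Q] are corrected by
    elements of [N], lifted through [g], and recombined into [t]. The annihilator is controlled
    because [Q] is injective in its first differential. *)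
Lemma pd_le1_lift M N P P1 (eps : {linear P -> M}) (iota : {linear N -> P})
    (g : {linear P1 -> N}) (y : N) :
  pd_le M 1 -> projective P -> surjective_fun eps -> injective iota ->
  (forall x, eps x = 0 <-> exists z, iota z = x) -> surjective_fun g ->
  exists2 t, g t = y & forall a, a *: y = 0 -> a *: t = 0.
Proof.
case=> Q Q0 projP eps_surj iota_inj exP g_surj.
have [u epsu] := projP _ _ _ eps (@pr_aug_surj _ _ Q).
have [v epsv] := @pr_projective _ _ Q 0 _ _ eps (pr_aug Q) eps_surj.
have d_inj z : pr_diff Q 0 z = 0 -> z = 0.
  by case/pr_exactS=> z' <-; rewrite (Q0 2%N isT z') linear0.
(* Preimages under [iota] are picked by [xchoose]; injectivity of [iota] makes the resulting map
   linear. *)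
have lift_iota (T : lmodType R) (f : {linear T -> P}) :
    (forall x, eps (f x) = 0) -> {f' : {linear T -> N} | forall x, iota (f' x) = f x}.
  move=> epsf; have ex x : exists z, iota z == f x.
    by have /exP[z <-] := epsf x; exists z.
  pose f0 x := xchoose (ex x).
  have f0E x : iota (f0 x) = f x by apply/eqP/(xchooseP (ex x)).
  have lf0 : linear f0.
    by move=> a x x'; apply: iota_inj; rewrite linearP !f0E linearP.
  have [f' f'E] := linear_map_ex lf0.
  by exists f' => x; rewrite f'E.
(* Both [u] and [v] lie over the identity of [M], so [v u - 1] lands in the kernel of [eps], that
   is, in [N]. *)
have [w' w'E] : {w : {linear P -> N} | forall x, iota (w x) = v (u x) - x}.
  have lw : linear (fun x => v (u x) - x).
    by move=> a x x' /=; rewrite !linearP scalerDr addrACA.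
  have [w wE] := linear_map_ex lw.
  have [x|w' w'E] := @lift_iota _ w; last by exists w' => x; rewrite w'E wE.
  by rewrite wE linearB /= epsv epsu subrr.
have [v' v'E] :
    {v' : {linear pr_obj Q 1 -> N} | forall z, iota (v' z) = v (pr_diff Q 0 z)}.
  have lv : linear (fun z => v (pr_diff Q 0 z)) by move=> a x x' /=; rewrite !linearP.
  have [v0 v0E] := linear_map_ex lv.
  have [z|v' v'E] := @lift_iota _ v0; last by exists v' => z; rewrite v'E v0E.
  by rewrite v0E epsv; apply/pr_exact0; exists z.
have [wt gwt] := projP _ _ g w' g_surj.
have [vt gvt] := @pr_projective _ _ Q 1 _ _ g v' g_surj.
have /pr_exact0[q dq] : pr_aug Q (u (iota y)) = 0.
  by rewrite epsu; apply/exP; exists y.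
(* Under [iota], the image of this element by [g] is [v (u y) - (v (u y) - y)], with [y] read in
   [P]. *)
exists (vt q - wt (iota y)) => [|a ay].
  rewrite linearB /= gvt gwt; apply: iota_inj.
  by rewrite linearB /= v'E w'E dq opprB addrC subrK.
have aq0 : a *: q = 0 by apply: d_inj; rewrite linearZ /= dq -!linearZ /= ay !linear0.
by rewrite scalerBr -!linearZ /= aq0 ay !linear0 addr0.
Qed.

End Resolutions.

(** * Principal right ideals as modules *)

Section PrincipalRightIdeals.
Variables (F : fieldType) (A : falgType F).

(** The ideal [a A] is stated as membership in a subspace in order to be a boolean predicate, from
    which a submodule type can be built. *)
Definition pright_pred (a : A) : {pred (A^c)^o} :=
  fun x => (x : A) \in (<[a]> * fullv)%VS.

Lemma prightP (a : A) (x : A) : reflect (exists b, x = a * b) (x \in pright_pred a).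
Proof.
apply: (iffP idP) => [|[b ->]].
  have /subvP sub : (<[a]> * fullv <= limg (amull a))%VS.
    apply/prodvP => _ v /vlineP[c ->] _; apply/memv_imgP.
    by exists (c *: v); rewrite ?memvf // lfunE /= -scalerAl scalerAr.
  by case/sub/memv_imgP=> b _ ->; exists b; rewrite lfunE.
by apply: memv_mul; rewrite ?memv_line ?memvf.
Qed.

Lemma pright_closed (a : A) : submod_closed (pright_pred a).
Proof.
split; first by apply/prightP; exists 0; rewrite mulr0.
move=> c x y /prightP[b ->] /prightP[b' ->]; apply/prightP.
by exists (b * (c : A) + b'); rewrite mulrDr mulrA.
Qed.

HB.instance Definition _ a :=
  GRing.isSubmodClosed.Build A^c (A^c)^o (pright_pred a) (pright_closed a).

Definition pright (a : A) := {x : (A^c)^o | x \in pright_pred a}.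

HB.instance Definition _ a := SubChoice.on (pright a).
HB.instance Definition _ a := [SubChoice_isSubLmodule of pright a by <:].

Definition pideal (a : A) : rmodType A := pright a.

End PrincipalRightIdeals.

(** * Linear Nakayama algebras *)

Section PathElements.
Variables (F : fieldType) (n : nat).

(* This is 0 unless i <= j <= n. *)
Definition npath (i j : nat) : pathalg F n :=
  [ffun p : lpath n => ((psrc p == i :> nat) && (ptgt p == j :> nat))%:R].

Lemma npathE (p : lpath n) : path_elt F p = npath (psrc p) (ptgt p).
Proof.
apply/ffunP => q; rewrite !ffunE; suff -> : (q == p) =
  (psrc q == psrc p :> nat) && (ptgt q == ptgt p :> nat) by [].
apply/eqP/andP => [->|[/eqP e1 /eqP e2]]; first by rewrite !eqxx.
by apply: lpath_inj; apply: val_inj.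
Qed.

Lemma npath_vertex (i : 'I_n.+1) : vertex_elt F i = npath i i.
Proof. by rewrite /vertex_elt npathE. Qed.

Lemma npath_out i j : ~~ (i <= j <= n)%N -> npath i j = 0.
Proof.
move=> out; apply/ffunP => p; rewrite !ffunE.
have := psrc_le_ptgt p; have := ltn_ord (ptgt p).
by case: eqP => //= ->; case: eqP => //= ->; lia.
Qed.

Lemma lpath_nat_ex i j : (i <= j <= n)%N ->
  exists p : lpath n, psrc p = i :> nat /\ ptgt p = j :> nat.
Proof.
move=> ijn; have lti : (i < n.+1)%N by lia.
have ltj : (j < n.+1)%N by lia.
have [|p [p1 p2]] := @lpath_ex n (Ordinal lti) (Ordinal ltj); first by move=> /=; lia.
by exists p; rewrite p1 p2.
Qed.

Lemma npath_mul i j l : (i <= j <= l)%N -> (l <= n)%N ->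
  npath i j * npath j l = npath i l.
Proof.
move=> ijl ln; have [|q [q1 q2]] := @lpath_nat_ex i j; first lia.
have [|r [r1 r2]] := @lpath_nat_ex j l; first lia.
have -> : npath i j = path_elt F q by rewrite npathE q1 q2.
have -> : npath j l = path_elt F r by rewrite npathE r1 r2.
apply/ffunP => p; rewrite [LHS]ffunE /= (bigD1 q) //= [X in _ + X]big1 => [|q' nq].
  rewrite addr0 big_mkcond (bigD1 r) //= [X in _ + X]big1 => [|r' nr].
    rewrite !ffunE !eqxx mulr1 addr0 /path_comp -!val_eqE /= q1 q2 r1 r2 eqxx /=.
    by case: ifP.
  by case: ifP; rewrite // !ffunE (negbTE nr) mulr0.
by apply: big1 => r' _; rewrite ffunE (negbTE nq) mul0r.
Qed.

Lemma npath_mul0 i j k l : j != k -> npath i j * npath k l = 0.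
Proof.
move=> njk; apply/ffunP => p; rewrite [LHS]ffunE [RHS]ffunE.
rewrite big1 // => q _; rewrite big1 // => r /and3P[/eqP qr _ _]; rewrite !ffunE qr.
by case: (eqVneq (psrc r : nat) j) => [->|_]; rewrite ?(negbTE njk) ?mulr0 // andbF mul0r.
Qed.

Lemma sum_npath : \sum_(i < n.+1) npath i i = 1.
Proof.
apply/ffunP => p; rewrite sum_ffunE [RHS]ffunE (bigD1 (psrc p)) //= ffunE eqxx.
rewrite big1 ?addr0 => [|i ni]; first by rewrite val_eqE eq_sym.
by rewrite ffunE val_eqE eq_sym (negbTE ni).
Qed.

Lemma npath_span (x : pathalg F n) :
  x = \sum_p x p *: npath (psrc p) (ptgt p).
Proof.
apply/ffunP => q; rewrite sum_ffunE (bigD1 q) //= big1 ?addr0 => [|p npq].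
  by rewrite !ffunE !eqxx /= -[RHS]/(x q * 1) mulr1.
rewrite -npathE !ffunE eq_sym (negbTE npq); exact: mulr0.
Qed.

End PathElements.

Section LNakayama.
Variables (F : fieldType) (n : nat) (A : falgType F).
Variable pi : {lrmorphism pathalg F n -> A}.
Hypothesis pi_surj : forall a : A, exists x, pi x = a.

(** This vanishes also when the path lies in the kernel of [pi]. Indices in [nat] allow [k.+1]
    without a bound. *)
Definition bpath (i j : nat) : A := pi (npath F n i j).
Local Notation E := bpath.

Lemma bpath_out i j : ~~ (i <= j <= n)%N -> E i j = 0.
Proof. by move=> out; rewrite /bpath npath_out ?linear0. Qed.

Lemma bpath_mul i j l : (i <= j <= l)%N -> E i j * E j l = E i l.
Proof.
move=> ijl; have [ln|nl] := leqP l n.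
  by rewrite /bpath -rmorphM npath_mul.
by rewrite [E j l]bpath_out ?[E i l]bpath_out ?mulr0 //; lia.
Qed.

Lemma bpath_mul0 i j k l : j != k -> E i j * E k l = 0.
Proof. by move=> njk; rewrite /bpath -rmorphM npath_mul0 ?rmorph0. Qed.

Lemma bpath_mulV i j : E i i * E i j = E i j.
Proof.
have [ij|nij] := boolP (i <= j)%N; first by rewrite bpath_mul ?leqnn.
by rewrite [E i j]bpath_out ?mulr0 // negb_and nij.
Qed.

Lemma bpath_mulI i j : E i j * E j j = E i j.
Proof.
have [ij|nij] := boolP (i <= j)%N; first by rewrite bpath_mul ?leqnn ?andbT.
by rewrite [E i j]bpath_out ?mul0r // negb_and nij.
Qed.

Lemma sum_bpath : \sum_(i < n.+1) E i i = 1.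
Proof. by rewrite -linear_sum /= sum_npath rmorph1. Qed.

Lemma bpath_ind (Q : A -> Prop) :
  Q 0 -> (forall a b, Q a -> Q b -> Q (a + b)) ->
  (forall c a, Q a -> Q (c *: a)) ->
  (forall i j, (i <= j <= n)%N -> Q (E i j)) -> forall a, Q a.
Proof.
move=> Q0 QD QZ QE a; have [x <-] := pi_surj a.
rewrite (npath_span x) linear_sum /=; apply: (big_ind Q) => // p _.
rewrite linearZ /=; apply/QZ/QE.
by rewrite psrc_le_ptgt -ltnS ltn_ord.
Qed.

(** At most one path leads from [i] to [j], so [e_i A e_j] has dimension at most one. *)
Lemma bpath_corner i j a : exists c : F, E i i * a * E j j = c *: E i j.
Proof.
elim/bpath_ind: a => [|a b [c Ea] [c' Eb]|c a [c' Ea]|k l kl].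
- by exists 0; rewrite mulr0 mul0r scale0r.
- by exists (c + c'); rewrite mulrDr mulrDl Ea Eb scalerDl.
- by exists (c * c'); rewrite -scalerAr -scalerAl Ea scalerA.
have [->|nik] := eqVneq i k; last by exists 0; rewrite bpath_mul0 // mul0r scale0r.
have [->|nlj] := eqVneq l j; last first.
  by exists 0; rewrite bpath_mulV bpath_mul0 // scale0r.
by exists 1; rewrite bpath_mulV bpath_mulI scale1r.
Qed.

Lemma bpath_corner0 i j a : (j < i)%N -> E i i * a * E j j = 0.
Proof.
move=> ji; have [c ->] := bpath_corner i j a.
by rewrite [E i j]bpath_out ?scaler0 // negb_and leqNgt ji.
Qed.

(** No path leads backwards from [j] to [l]. *)
Lemma bpath_mid0 i j l m a : (l < j)%N -> E i j * a * E l m = 0.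
Proof.
move=> lj; rewrite -[E i j]bpath_mulI -[E l m]bpath_mulV mulrA.
by rewrite -2!(mulrA (E i j)) bpath_corner0 // mulr0 mul0r.
Qed.

(** A path starting at [k] is trivial or begins with the arrow: [e_k A] is spanned by [e_k] modulo
    the arrow's right ideal. *)
Lemma bpath_top k a : exists c b, E k k * a = c *: E k k + E k k.+1 * b.
Proof.
elim/bpath_ind: a => [|a b [c [x Ea]] [c' [x' Eb]]|c a [c' [x Ea]]|i l il].
- by exists 0, 0; rewrite !mulr0 scale0r addr0.
- by exists (c + c'), (x + x'); rewrite !mulrDr scalerDl Ea Eb addrACA.
- by exists (c * c'), (c *: x); rewrite -!scalerAr Ea scalerDr scalerA.
have [->|nik] := eqVneq k i; last first.
  by exists 0, 0; rewrite bpath_mul0 // mulr0 scale0r addr0.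
have [<-|nil] := eqVneq i l.
  by exists 1, 0; rewrite bpath_mulV mulr0 addr0 scale1r.
by exists 0, (E i.+1 l); rewrite bpath_mulV scale0r add0r bpath_mul //; lia.
Qed.

(** Left-handed counterpart of [bpath_top], by the last arrow of a path; it bounds the dimension of
    Ext. *)
Lemma bpath_socle k a : exists c b,
  a * E k.+1 k.+1 = c *: E k.+1 k.+1 + b * E k k.+1.
Proof.
elim/bpath_ind: a => [|a b [c [x Ea]] [c' [x' Eb]]|c a [c' [x Ea]]|i l il].
- by exists 0, 0; rewrite !mul0r scale0r addr0.
- by exists (c + c'), (x + x'); rewrite !mulrDl scalerDl Ea Eb addrACA.
- by exists (c * c'), (c *: x); rewrite -!scalerAl Ea scalerDr scalerA.
have [->|nlk] := eqVneq l k.+1; last first.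
  by exists 0, 0; rewrite bpath_mul0 // mul0r scale0r addr0.
have [->|nik] := eqVneq i k.+1.
  by exists 1, 0; rewrite bpath_mulI mul0r addr0 scale1r.
have [lkn|ltnk] := leqP k.+1 n; last first.
  by exists 0, 0; rewrite mul0r scale0r addr0 bpath_mulI bpath_out //; lia.
have [lik|ltki] := leqP i k.
  by exists 0, (E i k); rewrite bpath_mulI scale0r add0r bpath_mul // lik /=.
by exists 0, 0; rewrite mul0r scale0r addr0 bpath_mulI bpath_out //; lia.
Qed.

Lemma bpath_interval i m j : (i <= m <= j)%N -> E i j != 0 -> E i m != 0.
Proof.
move=> imj; apply: contraNneq => Eim.
by rewrite -(@bpath_mul i m j) // Eim mul0r.
Qed.

(** The nonzero [E i j] form a basis of [e_i A]: right multiplication by [E j j] isolates one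
    coefficient of a linear relation. *)
Lemma kupisch_count (i : 'I_n.+1) :
  kupisch pi i = count (fun j => E i j != 0) (iota 0 n.+1).
Proof.
set t := [seq j <- iota 0 n.+1 | E i j != 0]; pose s := [seq E i j | j <- t].
have -> : count (fun j => E i j != 0) (iota 0 n.+1) = size s.
  by rewrite size_map size_filter.
have ut : uniq t by rewrite filter_uniq ?iota_uniq.
have frees : free s.
  apply/(@freeP _ _ _ (in_tuple s)) => c /= sum0 m.
  have lt_t (k : 'I_(size s)) : (k < size t)%N.
    by rewrite (leq_trans (ltn_ord k)) // size_map.
  have : (\sum_(k < size s) c k *: s`_k) * E (nth 0%N t m) (nth 0%N t m) = 0.
    by rewrite sum0 mul0r.
  rewrite mulr_suml (bigD1 m) //= big1 ?addr0 => [|k nkm]; last first.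
    rewrite (nth_map 0%N) // -scalerAl bpath_mul0 ?scaler0 //.
    by rewrite nth_uniq.
  rewrite (nth_map 0%N) // -scalerAl bpath_mulI => /eqP; rewrite scaler_eq0.
  have : nth 0%N t m \in t by rewrite mem_nth.
  by rewrite mem_filter => /andP[/negbTE-> _]; rewrite orbF => /eqP.
move: frees; rewrite /free => /eqP <-; rewrite /kupisch npath_vertex -/(E i i).
congr (\dim _); apply/eqP; rewrite eqEsubv; apply/andP; split; apply/subvP => x.
  move=> /(prightP (E i i)) [b ->]; elim/bpath_ind: b => [|a b Ea Eb|c a Ea|k l kl].
  - by rewrite mulr0 mem0v.
  - by rewrite mulrDr memvD.
  - by rewrite -scalerAr memvZ.
  have [<-|nik] := eqVneq (i : nat) k; last by rewrite bpath_mul0 // mem0v.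
  rewrite bpath_mulV; have [->|nz] := eqVneq (E i l) 0; first by rewrite mem0v.
  by apply/memv_span/map_f; rewrite mem_filter nz mem_iota /=; lia.
move: x; apply/subvP/span_subvP => _ /mapP[j _ ->].
by apply/(prightP (E i i)); exists (E i j); rewrite bpath_mulV.
Qed.

(** By [bpath_interval] the endpoints of nonzero paths from [i] form an interval starting at [i],
    which is determined by its size. *)
Lemma bpath_kupisch (i : 'I_n.+1) j :
  (E i j != 0) = (i <= j < i + kupisch pi i)%N.
Proof.
rewrite kupisch_count -size_filter; set t := filter _ _.
have ut : uniq t by rewrite filter_uniq ?iota_uniq.
have inE0 k : E i k != 0 -> (i <= k <= n)%N.
  by apply: contraNT => out; rewrite bpath_out.
have tE k : (k \in t) = (E i k != 0).
  rewrite mem_filter mem_iota /=; case: eqVneq => //= nz.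
  by have := inE0 k nz; lia.
have [le_ij|lt_ji] := leqP i j; last by rewrite bpath_out ?eqxx //; lia.
rewrite /=; apply/idP/idP => [nz|].
  suff : (size (iota i (j - i).+1) <= size t)%N by rewrite size_iota; lia.
  apply: uniq_leq_size; first exact: iota_uniq.
  move=> k; rewrite mem_iota tE => ikj; apply: bpath_interval nz; lia.
apply: contraTT => z; rewrite -leqNgt.
suff : (size t <= size (iota i (j - i)))%N by rewrite size_iota; lia.
apply: uniq_leq_size => // k; rewrite tE mem_iota => nz.
have := inE0 k nz; case: (leqP j k) => [jk|]; last lia.
by case/negP: z; apply: bpath_interval nz; lia.
Qed.

End LNakayama.

(** * Simple modules *)

Section RightModules.
Variables (F : fieldType) (A : falgType F).
Implicit Types (M N : rmodType A).

(** Right action with products in the order of [A], hiding the opposite algebra. *)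
Definition ract M (s : M) (a : A) : M := (a : A^c) *: s.

Lemma ractM M (s : M) a b : ract (ract s a) b = ract s (a * b).
Proof. exact: scalerA. Qed.

Lemma ractD M (s : M) a b : ract s (a + b) = ract s a + ract s b.
Proof. exact: scalerDl. Qed.

Lemma ractB M (s : M) a b : ract s (a - b) = ract s a - ract s b.
Proof. exact: scalerBl. Qed.

Lemma ract1 M (s : M) : ract s 1 = s.
Proof. exact: scale1r. Qed.

Lemma ractr0 M (s : M) : ract s 0 = 0.
Proof. exact: scale0r. Qed.

Lemma ract0 M a : ract (0 : M) a = 0.
Proof. exact: scaler0. Qed.

Lemma ractZ M (s : M) (c : F) a : ract s (c *: a) = fscale c (ract s a).
Proof. by rewrite [RHS]ractM mulr_algr. Qed.

Lemma ract_linear M N (f : {linear M -> N}) s a : f (ract s a) = ract (f s) a.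
Proof. exact: linearZ. Qed.

Lemma fscale_eq0 M (c : F) (s : M) : fscale c s = 0 -> c = 0 \/ s = 0.
Proof.
have [->|c0 cs] := eqVneq c 0; [by left | right].
have := congr1 (fun y => ract y (c^-1)%:A) cs.
by rewrite ract0 [LHS]ractM -scalerAl mul1r scalerA mulfV // scale1r ract1.
Qed.

Lemma val_ract (b : A) (x : pideal b) a : val (ract x a) = (val x : A) * a.
Proof. by []. Qed.

Lemma pideal_linear (b : A) M (m : M) :
  {g : {linear pideal b -> M} | forall x, g x = ract m (val x)}.
Proof.
apply: linear_map_ex => c x y.
by rewrite /ract scalerA -scalerDl.
Qed.

Definition pideal_gen (b : A) : pideal b :=
  exist (fun x : (A^c)^o => x \in pright_pred b) b
    (introT (prightP b b) (ex_intro _ 1 (esym (mulr1 b)))).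

Lemma pideal_map (a b c : A) : (exists y, a * b = c * y) ->
  {g : {linear pideal b -> pideal c} | forall x, val (g x) = a * (val x : A)}.
Proof.
move=> abc; have Px (x : pideal b) : (a * (val x : A) : (A^c)^o) \in pright_pred c.
  have /prightP[z ->] := valP x; apply/prightP; have [y ab] := abc.
  by exists (y * z); rewrite !mulrA ab.
pose f (x : pideal b) : pideal c :=
  exist (fun x : (A^c)^o => x \in pright_pred c) _ (Px x).
have lf : linear f.
  move=> r x y; apply: val_inj => /=.
  by rewrite [LHS](mulrDr (a : A) ((val x : A) * (r : A)) (val y : A)) mulrA.
have [g gE] := linear_map_ex lf.
by exists g => x; rewrite gE.
Qed.

(** A map out of [e A] is determined by the image of [e]; a preimage [m] of that image gives the
    lift sending [x] to [m x], because [e x = x] on [e A]. *)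
Lemma pideal_projective (e : A) : e * e = e -> projective (pideal e).
Proof.
move=> ee M N g f g_surj; have [m gm] := g_surj (f (pideal_gen e)).
have [h hE] := pideal_linear e m; exists h => x; rewrite hE ract_linear gm -ract_linear.
congr (f _); apply: val_inj; rewrite val_ract /=.
by have /prightP[b ->] := valP x; rewrite mulrA ee.
Qed.

End RightModules.

(** * Homological invariants of a simple module *)

Section SimpleModule.
Variables (F : fieldType) (n : nat) (A : falgType F).
Variable pi : {lrmorphism pathalg F n -> A}.
Hypothesis pi_surj : forall a : A, exists x, pi x = a.
Local Notation E := (bpath pi).
Variables (k : nat) (S : rmodType A) (x : S).
Hypotheses (alpha_neq0 : E k k.+1 != 0).
Hypotheses (simpleS : is_simple S) (x_neq0 : x <> 0) (xE : ract x (E k k) = x).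

Lemma simple_cyclic (y : S) : y <> 0 -> forall s, exists a, s = ract y a.
Proof.
move=> y0; case: simpleS => _ /(_ (fun s => exists a, s = ract y a)) [].
- split; first by exists 0; rewrite ractr0.
    by move=> _ _ [a ->] [b ->]; exists (a + b); rewrite ractD.
  by move=> c _ [a ->]; exists (a * (c : A)); rewrite -ractM.
- by move=> U0; case: y0; apply: U0; exists 1; rewrite ract1.
by [].
Qed.

(** If [x] times the arrow were nonzero, it would generate [x = x e_k], but no path returns from
    [k.+1] to [k]. *)
Lemma simple_rad b : ract x (E k k.+1 * b) = 0.
Proof.
rewrite -ractM; have [->|/eqP y0] := eqVneq (ract x (E k k.+1)) 0.
  by rewrite ract0.
have [a xa] := simple_cyclic y0 x.
have {}xa : x = ract x (E k k.+1 * a * E k k) by rewrite -!ractM -xa xE.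
by case: x_neq0; rewrite xa bpath_mid0 // ractr0.
Qed.

Lemma simple_ann a : ract x a = 0 -> exists b, E k k * a = E k k.+1 * b.
Proof.
have [c [b Ea]] := bpath_top pi_surj k a => xa.
exists b; rewrite Ea; suff -> : c = 0 by rewrite scale0r add0r.
have := xa; rewrite -{1}xE ractM Ea ractD simple_rad addr0 ractZ xE.
by case/fscale_eq0.
Qed.

Lemma idem_bpath i : E i i * E i i = E i i.
Proof. exact: bpath_mulV. Qed.

(** A lift [t] of [x] to [e_k A] would be killed by the arrow, as [x] is. But [t] has a nonzero
    coefficient at [e_k], so [t] times the arrow is a nonzero multiple of the arrow. *)
Lemma simple_not_projective : ~ pd_le S 0.
Proof.
have [g gE] := pideal_linear (E k k) x.
move=> pd0; have [s|t gt tE] := pd_le0_lift x pd0 (g := g).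
  have [a ->] := simple_cyclic x_neq0 s.
  exists (ract (pideal_gen (E k k)) a).
  by rewrite gE val_ract /= -ractM xE.
have tE1 : (val t : A) * E k k.+1 = 0.
  have := tE (E k k.+1 : A^c); rewrite -/(ract _ _) -/(ract _ _).
  move=> /(_ _)/(congr1 val); rewrite val_ract; apply.
  by rewrite -[E _ _]mulr1 simple_rad.
have /prightP[a ta] := valP t.
have [c [b Ea]] := bpath_top pi_surj k a; rewrite Ea in ta.
have := gt; rewrite gE ta ractD simple_rad addr0 ractZ xE => cx.
have c0 : c != 0.
  by apply/eqP => c0; case: x_neq0; rewrite -cx c0 /fscale !scale0r.
have aba0 : E k k.+1 * b * E k k.+1 = 0.
  exact: bpath_mid0.
move: tE1; rewrite ta mulrDl aba0 addr0 -scalerAl bpath_mulV => /eqP.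
by rewrite scaler_eq0 (negbTE c0) (negbTE alpha_neq0).
Qed.

Lemma projective_cover :
  {g : {linear pideal (E k k) -> S} | (forall t, g t = ract x (val t)) /\ surjective_fun g
     /\ forall t, g t = 0 <-> exists b, val t = E k k.+1 * b}.
Proof.
have [g gE] := pideal_linear (E k k) x; exists g; split=> //; split=> [s|t].
  have [a ->] := simple_cyclic x_neq0 s; exists (ract (pideal_gen (E k k)) a).
  by rewrite gE val_ract /= -ractM xE.
rewrite gE; split=> [xt|[b ->]]; last exact: simple_rad.
have [b Eb] := simple_ann xt; exists b; rewrite -Eb.
by have /prightP[a ->] := valP t; rewrite mulrA idem_bpath.
Qed.

(** Lifting the arrow through [e_{k+1} A -> alpha A] by [pd_le1_lift] gives [t] with
    [alpha t = alpha], annihilated by all that annihilates [alpha]. As [t e_{k+1}] is a multiple of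
    [e_{k+1}], it equals [e_{k+1}]. *)
Lemma pd_eq1_inj : pd_eq S 1 -> forall a, E k k.+1 * a = 0 -> E k.+1 k.+1 * a = 0.
Proof.
case=> pd1 _ a aa0; have [g [gE [g_surj g_ker]]] := projective_cover.
set al := E k k.+1 in aa0 g_ker *.
(* The inclusion of [alpha A] into [e_k A], as left multiplication by 1. *)
have [|iota iotaE] := @pideal_map _ A 1 al (E k k).
  by exists al; rewrite mul1r bpath_mulV.
have [|h hE] := @pideal_map _ A al (E k.+1 k.+1) al; first by exists (E k.+1 k.+1).
have [|||||t ht tE] := @pd_le1_lift _ S (pideal al) (pideal (E k k)) _
  g iota h (pideal_gen al) pd1.
- exact/pideal_projective/idem_bpath.
- exact: g_surj.
- by move=> u v /(congr1 val); rewrite !iotaE !mul1r; apply: val_inj.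
- move=> u; rewrite g_ker; split=> [[b ub]|[z <-]].
    exists (ract (pideal_gen al) b); apply: val_inj.
    by rewrite iotaE mul1r ub.
  by have /prightP[b zb] := valP z; exists b; rewrite iotaE mul1r zb.
- move=> z; have /prightP[b zb] := valP z.
  exists (ract (pideal_gen (E k.+1 k.+1)) b); apply: val_inj.
  by rewrite hE val_ract /= mulrA bpath_mulI.
have ta0 : (val t : A) * (E k.+1 k.+1 * a) = 0.
  rewrite -val_ract [ract t _]tE //; apply: val_inj => /=.
  by rewrite -[LHS]/(al * (E k.+1 k.+1 * a)) mulrA bpath_mulI.
have al_t : al * (val t : A) = al by rewrite -hE ht.
have /prightP[b tb] := valP t.
have [c tc] := bpath_corner pi_surj k.+1 k.+1 b; rewrite -tb in tc.
have c1 : c = 1.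
  have := congr1 (fun z => al * z) tc; rewrite mulrA al_t -scalerAr /al !bpath_mulI.
  move/eqP; rewrite -subr_eq0 -{1}[E k k.+1]scale1r -scalerBl scaler_eq0.
  by rewrite (negbTE alpha_neq0) orbF subr_eq0 => /eqP.
by rewrite -[E k.+1 k.+1]scale1r -c1 -tc -mulrA.
Qed.

(** A map from [S] to [A] amounts to the image [y] of [x], with [y e_k = y] and [y alpha = 0].
    Componentwise [y] is a combination of paths [i -> k], so it exists nontrivially exactly when
    some nonzero path [i -> k] dies when prolonged to [k.+1]. *)
Lemma simple_hom0 :
  (forall (f : {linear S -> regular_rmod A}) s, f s = 0) <->
  (forall i, E i k != 0 -> E i k.+1 != 0).
Proof.
split=> [hom0 i nz|nzE f s].
  apply/eqP => z; move/negP: nz; apply; apply/eqP.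
  have ex s : exists a, s == ract x a.
    by have [a ->] := simple_cyclic x_neq0 s; exists a.
  pose co s := xchoose (ex s).
  have coE s : s = ract x (co s) by apply/eqP/(xchooseP (ex s)).
  have wd a : ract x a = 0 -> E i k * a = 0.
    case/simple_ann=> b ab; rewrite -bpath_mulI -mulrA ab mulrA.
    have [ik|ki] := leqP i k; first by rewrite bpath_mul ?ik ?leqnSn // z mul0r.
    by rewrite [E i k]bpath_out ?mul0r //; lia.
  have lf : linear (fun s => E i k * co s : regular_rmod A).
    move=> r s t /=; apply/eqP; rewrite -subr_eq0; apply/eqP.
    rewrite -[LHS]/(E i k * co (r *: s + t) - (E i k * co s * (r : A) + E i k * co t)).
    rewrite -mulrA -mulrDr -mulrBr; apply: wd.
    by rewrite ractB ractD -ractM -!coE subrr.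
  have [f fE] := linear_map_ex lf.
  have := hom0 f x; rewrite fE => /= fx0.
  (* [co x] and [e_k] act alike on [x], so the map takes the value [E i k] at [x]. *)
  have := wd (co x - E k k); rewrite ractB -coE xE subrr => /(_ erefl).
  by rewrite mulrBr fx0 sub0r bpath_mulI => /eqP; rewrite oppr_eq0 => /eqP.
have [a ->] := simple_cyclic x_neq0 s; rewrite ract_linear.
suff -> : f x = 0 by rewrite ract0.
set y : A := f x.
have yE : y * E k k = y by rewrite -[LHS](ract_linear f x (E k k)) xE.
have ya : y * E k k.+1 = 0.
  rewrite -[LHS](ract_linear f x) -[E k k.+1]mulr1 simple_rad; exact: linear0.
rewrite -[_ = _]/(y = 0 :> A) -[y]mul1r -(sum_bpath pi) mulr_suml big1 // => i _.
have [c yc] := bpath_corner pi_surj i k y; rewrite -mulrA yE in yc.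
rewrite yc; have [->|nz] := eqVneq (E i k) 0; first by rewrite scaler0.
have ik : (i <= k)%N.
  by apply: contraNT nz => nik; rewrite bpath_out // negb_and nik.
have := congr1 (fun z => z * E k k.+1) yc.
rewrite -mulrA ya mulr0 -scalerAl bpath_mul ?ik ?leqnSn // => /esym/eqP.
by rewrite scaler_eq0 (negbTE (nzE i nz)) orbF => /eqP->; rewrite scale0r.
Qed.

Hypothesis alpha_inj : forall a, E k k.+1 * a = 0 -> E k.+1 k.+1 * a = 0.

Lemma simple_ext1 : pd_eq S 1 /\ ext1_dim S (regular_rmod A) 1.
Proof.
have [g [gE [g_surj g_ker]]] := projective_cover.
have [|d dE] := @pideal_map _ A (E k k.+1) (E k.+1 k.+1) (E k k).
  by exists (E k k.+1); rewrite bpath_mulI bpath_mulV.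
have valE i (t : pideal (E i i)) : E i i * (val t : A) = val t.
  by have /prightP[b ->] := valP t; rewrite mulrA bpath_mulV.
have exact0 t : g t = 0 <-> exists y, d y = t.
  rewrite g_ker; split=> [[b tb]|[y <-]]; last by exists (val y); rewrite dE.
  exists (ract (pideal_gen (E k.+1 k.+1)) b); apply: val_inj.
  by rewrite dE val_ract /= tb mulrA bpath_mulI.
have d_inj y : d y = 0 -> y = 0.
  move/(congr1 val); rewrite dE => /alpha_inj; rewrite valE => y0.
  exact: val_inj.
have proj i : projective (pideal (E i i)) by apply/pideal_projective/idem_bpath.
split.
  split; first exact: (pd_le_short (proj _) (proj _) g_surj exact0 d_inj).
  by case=> // /simple_not_projective.
exists (short_resolution (proj _) (proj _) g_surj exact0 d_inj) => cocycle.
(* The basis class is that of the inclusion of [e_{k+1} A] into [A]. *)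
have [phi phiE] := pideal_linear (E k.+1 k.+1) (1 : regular_rmod A).
exists (fun _ => phi); split.
- by move=> _ y; rewrite /= linear0.
- move=> f _; set y : A := f (pideal_gen (E k.+1 k.+1)).
  have fE t : f t = y * (val t : A).
    rewrite -[RHS](ract_linear f); congr (f _); apply: val_inj.
    by rewrite val_ract /= valE.
  (* The summand ending in the arrow extends to [e_k A], hence is a coboundary. *)
  have [c [b yb]] := bpath_socle pi_surj k y.
  have [h hE] := pideal_linear (E k k) (b : regular_rmod A).
  exists (fun _ => c), h => t; rewrite big_ord1 hE phiE dE fE.
  rewrite -[fscale _ _]/(1 * (val t : A) * c%:A) mul1r mulr_algr.
  rewrite -[ract _ _]/(b * (E k k.+1 * (val t : A))) -{1}(valE _ t) mulrA yb.
  by rewrite mulrDl -scalerAl valE mulrA.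
move=> c h ch i; have {i}-> : i = ord0 by rewrite [i]ord1.
have := ch (pideal_gen (E k.+1 k.+1)); rewrite big_ord1 phiE.
rewrite -[fscale _ _]/(1 * E k.+1 k.+1 * (c ord0)%:A) mul1r mulr_algr.
have -> : d (pideal_gen (E k.+1 k.+1)) =
    ract (ract (pideal_gen (E k k)) (E k k)) (E k k.+1).
  by apply: val_inj; rewrite dE !val_ract /= idem_bpath bpath_mulI bpath_mulV.
rewrite !ract_linear; set y : A := h _ => cy.
(* Left multiplication by [e_{k+1}] kills the coboundary, since [e_{k+1} A e_k = 0]. *)
have := congr1 (fun z => E k.+1 k.+1 * z) cy.
rewrite -scalerAr idem_bpath -[ract _ _]/(y * E k k * E k k.+1) !mulrA.
rewrite bpath_corner0 // mul0r => /eqP; rewrite scaler_eq0 => /orP[/eqP//|/eqP e0].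
by case/eqP: alpha_neq0; rewrite -bpath_mulI e0 mulr0.
Qed.

End SimpleModule.

(** * From algebra to combinatorics *)

Lemma bpath_mull_inj (F : fieldType) n (A : falgType F)
    (pi : {lrmorphism pathalg F n -> A}) (k : nat) :
  (forall a : A, exists x, pi x = a) ->
  (forall a, bpath pi k k.+1 * a = 0 -> bpath pi k.+1 k.+1 * a = 0) <->
  (forall l, bpath pi k.+1 l != 0 -> bpath pi k l != 0).
Proof.
(* Left multiplication by the arrow sends the path [k.+1 -> l] to [k -> l], so injectivity can be
   tested separately for each endpoint [l]. *)
move=> pi_surj; split=> [inj l|nzE a aa0].
  apply: contraNneq => Ekl; have [kl|lk] := leqP k.+1 l; last first.
    by rewrite bpath_out ?eqxx //; lia.
  by apply/eqP; rewrite -bpath_mulV; apply: inj; rewrite bpath_mul //; lia.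
rewrite -[LHS]mulr1 -(sum_bpath pi) mulr_sumr big1 // => l _.
have [c Ec] := bpath_corner pi_surj k.+1 l a; rewrite Ec.
have [->|nz] := eqVneq (bpath pi k.+1 l) 0; first by rewrite scaler0.
have kl : (k.+1 <= l)%N.
  by apply: contraNT nz => nkl; rewrite bpath_out // negb_and nkl.
have := congr1 (fun z => bpath pi k k.+1 * z) Ec.
rewrite !mulrA bpath_mulI aa0 mul0r -scalerAr bpath_mul; last by lia.
move/esym/eqP; rewrite scaler_eq0 (negbTE (nzE l nz)) orbF => /eqP->.
exact: scale0r.
Qed.

Theorem theorem3p23 (F : fieldType) (n : nat) (D : seq step)
    (A : falgType F) (pi : {lrmorphism pathalg F n -> A}) :
  (1 <= n)%N ->
  is_dyck n D ->
  is_LNakayama pi ->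
  (forall i : 'I_n.+1, kupisch pi i = area (zeta n D) i) ->
  forall j : nat, (1 <= j <= n)%N ->
  forall S : rmodType A, simple_at pi (kvertex n D j) S ->
    (has_peak D j <-> pd_eq S 1) /\
    (has_one_rise D j <-> one_regular S).
Proof.
move=> _ dyckD [pi_surj _] kup j j_bd S [simpleS [x0 x0E]].
set k := kindex n D j; set h := area_h (zeta n D).
have lt_kn : (k < n)%N by rewrite /k kindexE // vrank_lt.
have lt_h i : (i < n)%N -> (i < h i)%N by exact: ltn_area_h_zeta.
(* For [i < n] the subtraction in [area] is not truncated, so the last endpoint [i + c_i - 1] is
   [h i]. *)
have nzE i l : (i < n)%N -> (bpath pi i l != 0) = (i <= l <= h i)%N.
  move=> lt_in; have lt_in1 : (i < n.+1)%N by apply: ltnW.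
  rewrite (bpath_kupisch pi_surj (Ordinal lt_in1)) kup /area /=.
  by have := lt_h i lt_in; rewrite -/h; lia.
have al_neq0 : bpath pi k k.+1 != 0 by rewrite nzE // leqnSn lt_h.
move: x0E; rewrite npath_vertex -/(bpath pi k k) -/(ract x0 _).
(* Replacing [x0] by [x0 e_k] gives a nonzero generator fixed by [e_k]. *)
set x := ract x0 _ => x_neq0.
have xE : ract x (bpath pi k k) = x by rewrite ractM bpath_mulV.
have injE : (forall a, bpath pi k k.+1 * a = 0 -> bpath pi k.+1 k.+1 * a = 0) <->
    (k.+1 < n -> h k.+1 <= h k)%N.
  rewrite bpath_mull_inj //; split=> [nz lt_k1n|hk l nz].
    have := nz (h k.+1); rewrite !nzE // leqnn andbT => /(_ (ltnW (lt_h _ lt_k1n))).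
    by case/andP.
  have : (k.+1 <= l <= n)%N by apply: contraNT nz => out; rewrite bpath_out.
  move=> kln; have [lt_k1n|le_nk1] := ltnP k.+1 n.
    by move: nz; rewrite !nzE //; have := hk lt_k1n; lia.
  (* If [k.+1 = n], only the trivial path starts at [k.+1], and its image is the nonzero arrow. *)
  by have -> : l = k.+1 by lia.
have pdE : pd_eq S 1 <-> has_peak D j.
  have peakE := peak_zeta dyckD j_bd; split=> [pd1|/peakE/injE].
    exact/peakE/injE/(pd_eq1_inj pi_surj al_neq0 simpleS x_neq0 xE).
  by case/(simple_ext1 pi_surj al_neq0 simpleS x_neq0 xE).
have homE : (forall i, bpath pi i k != 0 -> bpath pi i k.+1 != 0) <->
    (forall i, (i <= k)%N -> h i <> k).
  split=> [nz i le_ik hik|hk i nz].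
    by have := nz i; rewrite !nzE; lia.
  have le_ik : (i <= k)%N.
    by apply: contraNT nz => nik; rewrite bpath_out // negb_and nik.
  by move: nz (hk i le_ik); rewrite !nzE; lia.
split; first exact: iff_sym.
have riseE := one_rise_zeta dyckD j_bd.
have {}homE := iff_trans (simple_hom0 pi_surj al_neq0 simpleS x_neq0 xE) homE.
split=> [/riseE[/pdE pd1 /homE hom0]|[pd1 hom0 _]]; last first.
  by apply/riseE; split; [apply/pdE | apply/homE].
split=> //; have inj := pd_eq1_inj pi_surj al_neq0 simpleS x_neq0 xE pd1.
by case: (simple_ext1 pi_surj al_neq0 simpleS x_neq0 xE inj).
Qed.
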